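(* (i) Let $d\in\mathbb{N}$ and $r\in\mathbb{N}_0$. A Yang-Baxter representation of the Temperley-Lieb algebra $\mathrm{TL}(2)$ with rank $r$ and dimension $d$ exists if and only if $$d^2-4r=k^2$$ for some $k\in\mathbb{N}_0$. Two such representations are equivalent if and only if they have the same dimension and rank. (ii) Let $R$ be an involutive R-matrix of Temperley-Lieb type with dimension $d$ and rank $r$. Then its Thoma parameters other than $\beta_1,\beta_2$ all vanish, and $$\beta_1=\frac12\left(1+\sqrt{1-\frac{4r}{d^2}}\right),\qquad \beta_2=\frac12\left(1-\sqrt{1-\frac{4r}{d^2}}\right).$$
   Context: $\mathbb{N}=\{1,2,\dots\}$, $\mathbb{N}_0=\mathbb{N}\cup\{0\}$. An involutive R-matrix with base space $V$ (a nonzero finite-dimensional complex Hilbert space) and dimension $d=\dim V$ is a unitary $R\in\mathrm{End}(V\otimes V)$ with $R^2=1$ satisfying $R_1R_2R_1=R_2R_1R_2$, where for $X\in\mathrm{End}(V\otimes V)$, $X_1=X\otimes\mathrm{id}_V$, $X_2=\mathrm{id}_V\otimes X$ and generally $X_k=\mathrm{id}_V^{\otimes(k-1)}\otimes X\otimes\mathrm{id}_V\otimes\cdots$. Let $P=\frac12(R+1)$ be the spectral projection of $R$ to eigenvalue $+1$; the rank of $R$ is $r=\mathrm{Tr}_{V\otimes V}(P)$. $R$ is of Temperley-Lieb type if $P_1P_2P_1=\frac14P_1$ and $P_2P_1P_2=\frac14P_2$. $\mathrm{TL}(2)$ is the unital $*$-algebra with generators $T_k=T_k^*$, $k\in\mathbb{N}$,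 and relations $T_k^2=2T_k$, $T_kT_m=T_mT_k$ for $|k-m|\ge2$, $T_kT_mT_k=T_k$ for $|k-m|=1$. A Yang-Baxter representation of $\mathrm{TL}(2)$ of dimension $d$ and rank $r$ is one given by $T_k\mapsto 2P_k$ for an orthogonal projection $P\in\mathrm{End}(V\otimes V)$ of rank $r$, $\dim V=d$, satisfying the two relations above; equivalently it is given by an involutive R-matrix $R=2P-1$ of Temperley-Lieb type with dimension $d$ and rank $r$. Equivalence of two such representations means $R\sim S$ for the associated R-matrices: for every $n\in\mathbb{N}$, the unitary representations $\rho_R^{(n)}$ and $\rho_S^{(n)}$ of $S_n$ are equivalent, where $\rho_R^{(n)}$ acts on $V^{\otimes n}$ by $(k,k+1)\mapsto R_k$. The Thoma parameters of $R$ are those of its character $\chi_R(\sigma)=d^{-n}\mathrm{Tr}_{V^{\otimes n}}(\rho_R^{(n)}(\sigma))$, $\sigma\in S_n$ (an extremal character of $S_\infty=\bigcup_nS_n$): the unique real sequences $\alpha_1\ge\alpha_2\ge\dots\ge0$, $\beta_1\ge\beta_2\ge\dots\ge0$ with $\sum_i\alpha_i+\sum_i\beta_i\le1$ and $\chi_R(c_n)=\sum_i\alpha_i^n+(-1)^{n+1}\sum_i\beta_i^n$ on $n$-cycles $c_n$, $n\ge2$. *)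

(* Defs.v *)
From HB Require Import structures.
From mathcomp Require Import all_boot all_order all_algebra all_fingroup.
From mathcomp Require Import spectral sesquilinear mxrepresentation.
From mathcomp Require Import complex mxtens zify ring.
From mathcomp Require Import all_classical all_reals all_analysis.

Set Implicit Arguments.
Unset Strict Implicit.
Unset Printing Implicit Defensive.

Import Order.TTheory GRing.Theory Num.Theory.
Import numFieldNormedType.Exports.

Local Open Scope ring_scope.
Local Open Scope sesquilinear_scope.

(* V is C^d with its standard inner product, and End(V^{(x) n}) is 'M[C]_(d ^ n)
   with the Kronecker product *t of mxtens. Tensor legs are numbered from 0:
   [tens_at n k X] is the operator X_{k+1} on V^{(x) n}. When k.+1 < n the
   Kronecker product below has dimension d ^ n up to a cast, which conform_mx
   inserts; the default value 1 is only a placeholder for the other k. *)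
Definition tens_at {C : numClosedFieldType} {d : nat} (n k : nat)
    (X : 'M[C]_(d ^ 2)) : 'M[C]_(d ^ n) :=
  conform_mx 1%:M
    ((1%:M : 'M[C]_(d ^ k)) *t X *t (1%:M : 'M[C]_(d ^ (n - k.+2)))).

Record is_Rmatrix {C : numClosedFieldType} {d : nat} (S : 'M[C]_(d ^ 2)) : Prop :=
  IsRmatrix {
    Rmatrix_dim : (0 < d)%N;
    Rmatrix_unitary : S \is unitarymx;
    Rmatrix_invol : S *m S = 1%:M;
    Rmatrix_braid :
      tens_at 3 0 S *m tens_at 3 1 S *m tens_at 3 0 S
      = tens_at 3 1 S *m tens_at 3 0 S *m tens_at 3 1 S }.

Definition TL_relations {C : numClosedFieldType} {d : nat}
    (P : 'M[C]_(d ^ 2)) : Prop :=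
  tens_at 3 0 P *m tens_at 3 1 P *m tens_at 3 0 P = 4^-1 *: tens_at 3 0 P /\
  tens_at 3 1 P *m tens_at 3 0 P *m tens_at 3 1 P = 4^-1 *: tens_at 3 1 P.

(* Spectral projection of an involution S to the eigenvalue +1. *)
Definition proj_plus {C : numClosedFieldType} {d : nat}
    (S : 'M[C]_(d ^ 2)) : 'M[C]_(d ^ 2) := 2^-1 *: (S + 1%:M).

Definition TL_type {C : numClosedFieldType} {d : nat} (S : 'M[C]_(d ^ 2)) : Prop :=
  TL_relations (proj_plus S).

Definition has_rank {C : numClosedFieldType} {d : nat}
    (S : 'M[C]_(d ^ 2)) (r : nat) : Prop := \tr (proj_plus S) = r%:R.

(* The Yang-Baxter representation T_k |-> 2 P_k of TL(2); that the TL(2)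
   relations do hold on every V^{(x) n} is is_YBrep_TL2_relations below. *)
Record is_YBrep_TL2 {C : numClosedFieldType} (d r : nat)
    (P : 'M[C]_(d ^ 2)) : Prop :=
  IsYBrepTL2 {
    YBrep_dim : (0 < d)%N;
    YBrep_idem : P *m P = P;
    YBrep_selfadj : P ^t* = P;
    YBrep_rank : \rank P = r;
    YBrep_TL : TL_relations P }.

Definition Rmatrix_of {C : numClosedFieldType} {d : nat}
    (P : 'M[C]_(d ^ 2)) : 'M[C]_(d ^ 2) := 2 *: P - 1%:M.

Section TensAt.
Variables (C : numClosedFieldType) (d : nat).
Implicit Types X Y P : 'M[C]_(d ^ 2).

Let sq (m : nat) (A : 'M[C]_m) : {m & 'M[C]_m} := Tagged (fun m => 'M[C]_m) A.

Let sq_inj m (A B : 'M[C]_m) : sq A = sq B -> A = B.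
Proof. by move/eqP; rewrite eq_Tagged => /eqP. Qed.

Let sq_cast m n (e : m = n) (A : 'M[C]_m) : sq (castmx (e, e) A) = sq A.
Proof. by case: n / e; rewrite castmx_id. Qed.

Let tS (u v : {m & 'M[C]_m}) : {m & 'M[C]_m} := sq (tagged u *t tagged v).

Let sq_tens m n (A : 'M[C]_m) (B : 'M[C]_n) : sq (A *t B) = tS (sq A) (sq B).
Proof. by []. Qed.

Let sq_mul m m' (A B : 'M[C]_m) (A' B' : 'M[C]_m') :
  sq A = sq A' -> sq B = sq B' -> sq (A *m B) = sq (A' *m B').
Proof.
move=> eA; have em : m = m' := congr1 (@tag _ _) eA.
by case: m' / em A' B' eA => A' B' /sq_inj -> /sq_inj ->.
Qed.

Let tSA : associative tS.
Proof.
move=> [m A] [n B] [p D]; rewrite /tS /= -(sq_cast (mulnA m n p)); congr sq.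
apply/matrixP=> i j; rewrite castmxE.
case: (mxtens_indexP i) => i1 i3; case: (mxtens_indexP j) => j1 j3.
case: (mxtens_indexP i1) => i0 i2; case: (mxtens_indexP j1) => j0 j2.
have E (a : 'I_m) (b : 'I_n) (c : 'I_p) :
    cast_ord (esym (mulnA m n p)) (mxtens_index (mxtens_index (a, b), c))
    = mxtens_index (a, mxtens_index (b, c)).
  by apply: val_inj; rewrite /= mulnDl addnA -mulnA.
by rewrite !E !tensmxE mulrA.
Qed.

Let tens11 m n : (1%:M : 'M[C]_m) *t (1%:M : 'M[C]_n) = 1%:M.
Proof.
apply/matrixP=> i j.
case: (mxtens_indexP i) => i1 i2; case: (mxtens_indexP j) => j1 j2.
rewrite tensmxE !mxE (can_eq (@mxtens_indexK _ _)) xpair_eqE.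
by case: (i1 == j1); case: (i2 == j2); rewrite ?mul0r ?mulr0 ?mulr1.
Qed.


Let one a : {m & 'M[C]_m} := sq (1%:M : 'M[C]_(d ^ a)).

Let one_tens a b : tS (one a) (one b) = one (a + b).
Proof. by rewrite /one -sq_tens tens11 expnD. Qed.

(* [emb n k A] is 1 (x) A (x) 1 on V^{(x) n}, for A on V^{(x) m} with k legs to its left. *)
Let emb n k m (A : 'M[C]_(d ^ m)) : 'M[C]_(d ^ n) :=
  conform_mx 1%:M
    ((1%:M : 'M[C]_(d ^ k)) *t A *t (1%:M : 'M[C]_(d ^ (n - (k + m))))).

Let dimE n k m : (k + m <= n)%N -> (d ^ k * d ^ m * d ^ (n - (k + m)) = d ^ n)%N.
Proof. by move=> kn; rewrite -!expnD subnKC. Qed.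

Let embE n k m (A : 'M[C]_(d ^ m)) : (k + m <= n)%N ->
  sq (emb n k A) = tS (tS (one k) (sq A)) (one (n - (k + m))).
Proof.
move=> kn; rewrite -!sq_tens /emb -(sq_cast (dimE kn)); congr sq.
by rewrite -(conform_castmx (dimE kn, dimE kn)) conform_mx_id.
Qed.

Let emb_emb n k m l p (A : 'M[C]_(d ^ m)) : (k + p <= n)%N -> (l + m <= p)%N ->
  emb n k (emb p l A) = emb n (k + l) A.
Proof.
move=> kn lp; apply: sq_inj; rewrite !embE //; last by lia.
rewrite !tSA one_tens -[LHS]tSA one_tens; congr (tS _ (one _)); lia.
Qed.

Let embM n k m (A B : 'M[C]_(d ^ m)) : (k + m <= n)%N ->
  emb n k (A *m B) = emb n k A *m emb n k B.
Proof.
move=> kn; apply: sq_inj; rewrite (sq_mul (embE A kn) (embE B kn)) embE //.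
by rewrite -!sq_tens /= !tensmx_mul !mulmx1.
Qed.

Let embZ n k m a (A : 'M[C]_(d ^ m)) : (k + m <= n)%N ->
  emb n k (a *: A) = a *: emb n k A.
Proof.
have sqZ p q (B : 'M[C]_p) (D : 'M[C]_q) : sq B = sq D -> sq (a *: B) = sq (a *: D).
  move=> e; have ep : p = q := congr1 (@tag _ _) e.
  by case: q / ep D e => D /sq_inj ->.
move=> kn; apply: sq_inj; rewrite (sqZ _ _ _ _ (embE A kn)) embE //; congr sq.
by apply/matrixP=> i j; rewrite !mxE mulrCA !mulrA.
Qed.

Let emb1 n k m : (k + m <= n)%N -> emb n k (1%:M : 'M[C]_(d ^ m)) = 1%:M.
Proof.
by move=> kn; apply: sq_inj; rewrite embE // !one_tens subnKC.
Qed.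

Let emb_comm n k l m p (A : 'M[C]_(d ^ m)) (B : 'M[C]_(d ^ p)) :
  (k + m <= l)%N -> (l + p <= n)%N ->
  emb n k A *m emb n l B = emb n l B *m emb n k A.
Proof.
move=> kl ln; have kn : (k + m <= n)%N by lia.
have EA : sq (emb n k A) = tS (sq (emb l k A)) (one (n - l)).
  rewrite !embE // -[RHS]tSA one_tens; congr (tS _ (one _)); lia.
have EB : sq (emb n l B) = tS (one l) (sq (emb (n - l)%N 0 B)).
  rewrite !embE //; last by lia.
  by rewrite !tSA one_tens addn0; congr (tS _ (one _)); lia.
apply: sq_inj; rewrite (sq_mul EA EB) (sq_mul EB EA) /= !tensmx_mul.
by rewrite !mulmx1 !mul1mx.
Qed.

Let tens_at_emb n k X : tens_at n k X = emb n k X.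
Proof. by rewrite /tens_at /emb addn2. Qed.

Lemma tens_at1 n k : (k.+1 < n)%N -> tens_at n k 1%:M = 1%:M :> 'M[C]_(d ^ n).
Proof. by move=> kn; rewrite tens_at_emb emb1 ?addn2. Qed.

Lemma tens_atM n k X Y : (k.+1 < n)%N ->
  tens_at n k (X *m Y) = tens_at n k X *m tens_at n k Y.
Proof. by move=> kn; rewrite !tens_at_emb embM ?addn2. Qed.

Lemma tens_atZ n k a X : (k.+1 < n)%N ->
  tens_at n k (a *: X) = a *: tens_at n k X.
Proof. by move=> kn; rewrite !tens_at_emb embZ ?addn2. Qed.

Lemma tens_atD n k X Y : (k.+1 < n)%N ->
  tens_at n k (X + Y) = tens_at n k X + tens_at n k Y.
Proof.
have sqD p q (B B' : 'M[C]_p) (D D' : 'M[C]_q) :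
    sq B = sq D -> sq B' = sq D' -> sq (B + B') = sq (D + D').
  move=> e; have ep : p = q := congr1 (@tag _ _) e.
  by case: q / ep D D' e => D D' /sq_inj -> /sq_inj ->.
move=> kn; rewrite -addn2 in kn; rewrite !tens_at_emb; apply: sq_inj.
rewrite (sqD _ _ _ _ _ _ (embE X kn) (embE Y kn)) embE //; congr sq.
by apply/matrixP=> i j; rewrite !mxE mulrDr mulrDl.
Qed.

Lemma tens_at_adj n k X : (k.+1 < n)%N -> tens_at n k (X ^t*) = (tens_at n k X) ^t*.
Proof.
have sqJ p q (B : 'M[C]_p) (D : 'M[C]_q) : sq B = sq D -> sq (B ^t*) = sq (D ^t*).
  move=> e; have ep : p = q := congr1 (@tag _ _) e.
  by case: q / ep D e => D /sq_inj ->.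
move=> kn; rewrite -addn2 in kn; apply: sq_inj.
rewrite !tens_at_emb (sqJ _ _ _ _ (embE X kn)) embE //= !trmx_tens !map_mxT.
by rewrite !trmx1 !map_mx1.
Qed.

Lemma tens_at_comm n k l X Y : (k.+1 < l)%N -> (l.+1 < n)%N ->
  tens_at n k X *m tens_at n l Y = tens_at n l Y *m tens_at n k X.
Proof. by move=> kl ln; rewrite !tens_at_emb emb_comm ?addn2. Qed.

Let tens_at_emb3 n k l X : (k.+2 < n)%N -> (l < 2)%N ->
  tens_at n (k + l) X = emb n k (tens_at 3 l X).
Proof. by move=> kn l2; rewrite !tens_at_emb emb_emb //; lia. Qed.

Lemma tens_at_braid n k X : (k.+2 < n)%N ->
  tens_at 3 0 X *m tens_at 3 1 X *m tens_at 3 0 X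
  = tens_at 3 1 X *m tens_at 3 0 X *m tens_at 3 1 X ->
  tens_at n k X *m tens_at n k.+1 X *m tens_at n k X
  = tens_at n k.+1 X *m tens_at n k X *m tens_at n k.+1 X.
Proof.
move=> kn b; rewrite -addn1 -[in tens_at n k X](addn0 k) !tens_at_emb3 //.
by rewrite -!embM ?addn3 // b.
Qed.

Lemma tens_at_TL n k P : (k.+2 < n)%N -> TL_relations P ->
  tens_at n k P *m tens_at n k.+1 P *m tens_at n k P = 4^-1 *: tens_at n k P /\
  tens_at n k.+1 P *m tens_at n k P *m tens_at n k.+1 P
  = 4^-1 *: tens_at n k.+1 P.
Proof.
move=> kn [b1 b2]; rewrite -addn1 -[in tens_at n k P](addn0 k) !tens_at_emb3 //.
by rewrite -!embM ?addn3 // b1 b2 !embZ ?addn3.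
Qed.

End TensAt.

Lemma is_YBrep_TL2_relations {C : numClosedFieldType} (d r : nat)
    (P : 'M[C]_(d ^ 2)) (n : nat) : is_YBrep_TL2 r P ->
  let T k := 2 *: tens_at n k P in
  [/\ forall k, (k.+1 < n)%N -> (T k)^t* = T k,
      forall k, (k.+1 < n)%N -> T k *m T k = 2 *: T k,
      forall k l, (k.+1 < l)%N -> (l.+1 < n)%N -> T k *m T l = T l *m T k
    & forall k, (k.+2 < n)%N ->
        T k *m T k.+1 *m T k = T k /\ T k.+1 *m T k *m T k.+1 = T k.+1].
Proof.
case=> _ PP Pa _ TL T.
split=> [k kn|k kn|k l kl ln|k kn]; rewrite /T.
- by rewrite linearZ map_mxZ rmorph_nat -tens_at_adj // Pa.
- by rewrite -scalemxAl -scalemxAr -tens_atM // PP.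
- by rewrite -!scalemxAl -!scalemxAr tens_at_comm.
have [b1 b2] := tens_at_TL kn TL.
rewrite -!(scalemxAl, scalemxAr) !scalerA b1 b2 !scalerA.
by split; congr (_ *: _); field.
Qed.

Lemma proj_plusK {C : numClosedFieldType} (d : nat) (P : 'M[C]_(d ^ 2)) :
  proj_plus (Rmatrix_of P) = P.
Proof. by rewrite /proj_plus subrK scalerA mulVf ?scale1r ?pnatr_eq0. Qed.

Lemma Rmatrix_of_is_Rmatrix {C : numClosedFieldType} (d r : nat)
    (P : 'M[C]_(d ^ 2)) : is_YBrep_TL2 r P -> is_Rmatrix (Rmatrix_of P).
Proof.
case=> d0 PP Pa _ [TL1 TL2].
have RR : Rmatrix_of P *m Rmatrix_of P = 1%:M.
  rewrite /Rmatrix_of mulmxBr mulmxBl mulmx1 mul1mx -scalemxAl -scalemxAr PP.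
  by apply/matrixP=> i j; rewrite !mxE; ring.
have Ra : (Rmatrix_of P) ^t* = Rmatrix_of P.
  by rewrite /Rmatrix_of linearB linearZ map_mxB map_mxZ rmorph_nat /= Pa trmx1 map_mx1.
split=> //; first by apply/unitarymxP; rewrite Ra.
have braid m (a b : 'M[C]_m) : a *m a = a -> a *m b *m a = 4^-1 *: a ->
    (2 *: a - 1%:M) *m (2 *: b - 1%:M) *m (2 *: a - 1%:M)
    = 2 *: a + 2 *: b - 4 *: (a *m b) - 4 *: (b *m a) - 1%:M.
  move=> aa aba; rewrite !(mulmxBr, mulmxBl, mulmx1, mul1mx) -!(scalemxAl, scalemxAr) aba aa.
  by apply/matrixP=> i j; rewrite !mxE; field.
have atE k : (k.+1 < 3)%N ->
    tens_at 3 k (Rmatrix_of P) = 2 *: tens_at 3 k P - 1%:M.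
  move=> k3; rewrite /Rmatrix_of tens_atD // tens_atZ // -scaleN1r tens_atZ //.
  by rewrite tens_at1 // scaleN1r.
rewrite !atE // !braid // -?tens_atM ?PP //.
by apply/matrixP=> i j; rewrite !mxE; ring.
Qed.

Lemma adj_tperm_subproof n (k : 'I_n.-1) : (k.+1 < n)%N.
Proof. by rewrite -ltn_predRL. Qed.

(* Transposition of the k-th and (k+1)-st element of 'I_n, counted from 0. *)
Definition adj_tperm n (k : 'I_n.-1) : 'S_n :=
  tperm (widen_ord (leq_pred n) k) (Ordinal (adj_tperm_subproof k)).

Lemma adj_tperm_gen n (s : 'S_n) :
  exists w : seq 'I_n.-1, (\prod_(k <- w) adj_tperm k)%g == s.
Proof.
have gt m (i j : 'I_n) : (j = i + m.+1 :> nat)%N ->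
    exists w : seq 'I_n.-1, (\prod_(k <- w) adj_tperm k)%g = tperm i j.
  elim: m i j => [|m IHm] i j ij.
    have kn : (i < n.-1)%N by have := ltn_ord j; lia.
    exists [:: Ordinal kn]; rewrite big_seq1 /adj_tperm; congr tperm; apply: val_inj => //=.
    by rewrite ij addn1.
  have kn : (i + m.+1 < n.-1)%N by have := ltn_ord j; lia.
  have [w Ew] := IHm i (widen_ord (leq_pred n) (Ordinal kn)) erefl.
  exists (Ordinal kn :: rcons w (Ordinal kn)).
  rewrite big_cons -cats1 big_cat big_seq1 /= Ew; set t := adj_tperm _.
  have tV : (t^-1 = t)%g by exact: tpermV.
  rewrite -{1}tV -conjgE tpermJ /t tpermD; last 2 first.
  - by apply/eqP => /(congr1 val) /=; lia.
  - by apply/eqP => /(congr1 val) /=; lia.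
  rewrite /adj_tperm tpermL.
  by congr tperm; apply: val_inj => /=; lia.
have gt' (i j : 'I_n) : i != j ->
    exists w : seq 'I_n.-1, (\prod_(k <- w) adj_tperm k)%g = tperm i j.
  move=> nij; case: (ltngtP i j) => [ij|ji|/val_inj ij]; last by rewrite ij eqxx in nij.
    by apply: (gt (j - i.+1)%N); lia.
  by rewrite tpermC; apply: (gt (i - j.+1)%N); lia.
have [ts -> /allP dts] := prod_tpermP s.
elim: ts dts => [|t ts IH] dts; first by exists [::]; rewrite !big_nil.
have [|w /eqP Ew] := IH; first by move=> u uts; apply: dts; rewrite inE uts orbT.
have [w' Ew'] := gt' _ _ (dts t (mem_head _ _)).
by exists (w' ++ w); rewrite big_cat /= Ew Ew' big_cons.
Qed.

Definition adj_word n (s : 'S_n) : seq 'I_n.-1 := xchoose (adj_tperm_gen s).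

Lemma adj_wordE n (s : 'S_n) : (\prod_(k <- adj_word s) adj_tperm k)%g = s.
Proof. exact/eqP/(xchooseP (adj_tperm_gen s)). Qed.

(* rho_S^(n), computed on a chosen word in the adjacent transpositions. By
   rho_repr and rho_adj_tperm it is, for an R-matrix S, the homomorphism sending
   the k-th adjacent transposition to S_k. The product of 'S_n composes from left
   to right, so in terms of ordinary composition [rho S s] is rho_S(s^-1); this
   affects neither characters nor equivalence. *)
Definition rho {C : numClosedFieldType} {d : nat} (S : 'M[C]_(d ^ 2)) {n : nat}
    (s : 'S_n) : 'M[C]_(d ^ n) :=
  \prod_(k <- adj_word s) tens_at n k S.

Section Coxeter.
Variables (A : pzSemiRingType) (g : nat -> A) (m : nat).
Hypothesis g_sq : forall k, (k < m)%N -> g k * g k = 1.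
Hypothesis g_comm :
  forall k l, (k.+1 < l)%N -> (l < m)%N -> g k * g l = g l * g k.
Hypothesis g_braid : forall k, (k.+1 < m)%N ->
  g k * g k.+1 * g k = g k.+1 * g k * g k.+1.

Let swap k i := if i == k then k.+1 else if i == k.+1 then k else i.
Let swapP k i : i = k /\ swap k i = k.+1 \/ i = k.+1 /\ swap k i = k \/
  i <> k /\ i <> k.+1 /\ swap k i = i.
Proof. by rewrite /swap; case: eqP => ik; [|case: eqP => ik']; lia. Qed.

Ltac swap_lia :=
  repeat match goal with
  | |- context [swap ?k ?i] => generalize (swapP k i); generalize (swap k i)
  end; lia.

Let act (w : seq nat) i := foldl (fun i k => swap k i) i w.
Let ev (w : seq nat) : A := \prod_(k <- w) g k.
Let eqv u v := ev u = ev v /\ act u =1 act v.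

Let ev_cat u v : ev (u ++ v) = ev u * ev v.
Proof. by rewrite /ev big_cat. Qed.

Let act_cat u v i : act (u ++ v) i = act v (act u i).
Proof. by rewrite /act foldl_cat. Qed.

Let act_nil i : act [::] i = i. Proof. by []. Qed.

Let act_cons k w i : act (k :: w) i = act w (swap k i). Proof. by []. Qed.

Let eqv_refl u : eqv u u. Proof. by []. Qed.

Let eqv_trans v u w : eqv u v -> eqv v w -> eqv u w.
Proof. by move=> [E1 e1] [E2 e2]; split=> [|i]; rewrite ?E1 ?E2 ?e1 ?e2. Qed.

Let eqv_cat u u' v v' : eqv u u' -> eqv v v' -> eqv (u ++ v) (u' ++ v').
Proof.
move=> [e1 a1] [e2 a2]; split=> [|i]; first by rewrite !ev_cat e1 e2.
by rewrite !act_cat a1 a2.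
Qed.

Let eqv_sq k : (k < m)%N -> eqv [:: k; k] [::].
Proof.
move=> km; split=> [|i]; first by rewrite /ev !big_cons !big_nil mulr1 g_sq.
by rewrite !act_cons !act_nil; swap_lia.
Qed.

Let eqv_comm k l : (k.+1 < l)%N -> (l < m)%N -> eqv [:: l; k] [:: k; l].
Proof.
move=> kl lm; split=> [|i]; first by rewrite /ev !big_cons !big_nil !mulr1 (g_comm kl).
by rewrite !act_cons !act_nil; swap_lia.
Qed.

Let eqv_braid k : (k.+1 < m)%N -> eqv [:: k.+1; k; k.+1] [:: k; k.+1; k].
Proof.
move=> km; split=> [|i].
  by rewrite /ev !big_cons !big_nil !mulr1 !mulrA g_braid.
by rewrite !act_cons !act_nil; swap_lia.
Qed.

Let eqv_comm_gt k u :
  all (fun l => k.+1 < l < m)%N u -> eqv (u ++ [:: k]) (k :: u).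
Proof.
elim: u => [//|l u IHu] /= /andP[/andP[kl lm] /IHu e].
apply: (@eqv_trans ([:: l; k] ++ u)); first exact: (@eqv_cat [:: l] [:: l]).
by apply: (@eqv_cat _ [:: k; l]) => //; apply: eqv_comm.
Qed.

Let eqv_comm_lt k u : (k < m)%N ->
  all (fun l => l.+1 < k)%N u -> eqv (u ++ [:: k]) (k :: u).
Proof.
move=> km; elim: u => [//|l u IHu] /= /andP[lk /IHu e].
apply: (@eqv_trans ([:: l; k] ++ u)); first exact: (@eqv_cat [:: l] [:: l]).
apply: (@eqv_cat _ [:: k; l]) => //; have [e1 a1] := eqv_comm lk km.
by split=> [|i]; rewrite ?e1 ?a1.
Qed.

(* The word M-1, M-2, ..., j. *)
Let desc j M := rev (iota j (M - j)).

Let desc_rcons j M : (j < M)%N -> desc j M = desc j.+1 M ++ [:: j].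
Proof.
by move=> jM; rewrite /desc -(subnSK jM) /= rev_cons -cats1.
Qed.

Let desc_cat j s M : (j <= s <= M)%N -> desc j M = desc s M ++ desc j s.
Proof.
move=> /andP[js sM]; rewrite /desc -rev_cat; congr rev.
have -> : (M - j = (s - j) + (M - s))%N by lia.
by rewrite iotaD subnKC.
Qed.

Let mem_desc l j M : (l \in desc j M) = (j <= l < M)%N.
Proof. by rewrite mem_rev mem_iota; lia. Qed.

Let act_desc j M : (j <= M)%N -> act (desc j M) M = j.
Proof.
move=> jM; rewrite -(subKn jM); elim: (M - j)%N (leq_subr j M) => [|k IHk] kM.
  by rewrite subn0 /desc subnn.
rewrite desc_rcons; last by lia.
have -> : (M - k.+1).+1 = (M - k)%N by lia.
rewrite act_cat IHk ?act_cons ?act_nil; last by lia.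
by swap_lia.
Qed.

Let normal_form M w : (M < m)%N -> all (fun k => k <= M)%N w ->
  exists w' j, [/\ all (fun k => k < M)%N w', (j <= M.+1)%N
                 & eqv w (w' ++ desc j M.+1)].
Proof.
move=> Mm; elim/last_ind: w => [_|w s IHw].
  by exists [::], M.+1; rewrite /desc subnn.
rewrite all_rcons => /andP[sM /IHw[w' [j [w'M jM ew]]]].
have E u v : eqv (desc j M.+1 ++ [:: s]) (u ++ v) -> eqv (rcons w s) ((w' ++ u) ++ v).
  move=> e; rewrite -cats1 -catA; apply: (@eqv_trans ((w' ++ desc j M.+1) ++ [:: s])).
    exact: eqv_cat.
  by rewrite -catA; apply: eqv_cat.
have [sj|js] := ltnP s.+1 j.
  exists (w' ++ [:: s]), j; split=> //; first by rewrite all_cat w'M /=; lia.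
  apply/E/eqv_comm_gt/allP => l; rewrite mem_desc; lia.
have [sj|jS] := ltnP s j.
  exists (w' ++ [::]), s; split; [by rewrite cats0 | by lia | apply: E].
  have -> : j = s.+1 by lia.
  by rewrite -desc_rcons.
move: jS; rewrite leq_eqVlt => /predU1P[ejs|jS].
  subst s; exists (w' ++ [::]), j.+1; split; [by rewrite cats0 | by lia | apply: E].
  rewrite desc_rcons // -catA -[desc j.+1 _]cats0 /=; apply: eqv_cat => //.
    by rewrite cats0.
  by apply: eqv_sq; lia.
case: s jS js sM E => // s jS js sM E.
exists (w' ++ [:: s]), j; split=> //; first by rewrite all_cat w'M /=; lia.
apply: E; have -> : desc j M.+1 = desc s.+2 M.+1 ++ [:: s.+1; s] ++ desc j s.
  rewrite (@desc_cat j s.+2) ?(@desc_rcons s.+1) //; try lia.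
  rewrite (@desc_cat j s s.+2); last by lia.
  by rewrite (@desc_rcons s) // (@desc_rcons s.+1) // /desc subnn -!catA.
apply: (@eqv_trans (desc s.+2 M.+1 ++ [:: s.+1; s] ++ (s.+1 :: desc j s))).
  rewrite -!catA; do 2!apply: eqv_cat => //.
  by apply: eqv_comm_lt; [lia | apply/allP => l; rewrite mem_desc; lia].
apply: (@eqv_trans (desc s.+2 M.+1 ++ [:: s; s.+1; s] ++ desc j s)).
  apply: eqv_cat => //; apply: (@eqv_cat [:: s.+1; s; s.+1]) => //.
  by apply: eqv_braid; lia.
rewrite -[_ ++ _ ++ desc j s]/(_ ++ [:: s] ++ [:: s.+1; s] ++ desc j s).
rewrite [in X in eqv X]catA [in X in eqv _ X]catA; apply: eqv_cat => //.
by apply: eqv_comm_gt; apply/allP => l; rewrite mem_desc; lia.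
Qed.

Let act_fix M w : all (fun k => k < M)%N w -> act w M.+1 = M.+1.
Proof.
elim: w => // k w IHw /andP[kM wM]; rewrite act_cons.
have -> : swap k M.+1 = M.+1 by move: kM; rewrite /=; swap_lia.
exact: IHw.
Qed.

Let ev_trivial M w : (M <= m)%N -> all (fun k => k < M)%N w -> act w =1 id -> ev w = 1.
Proof.
elim: M w => [|M IHM] w Mm wM aw; first by case: w wM {aw} => // _; rewrite /ev big_nil.
have [w' [j [w'M jM [-> a]]]] := normal_form Mm wM.
have jE : j = M.+1 by have := aw M.+1; rewrite a act_cat act_fix // act_desc.
move: a; rewrite jE /desc subnn cats0 => a; apply: (IHM) => //; first by lia.
by move=> i; rewrite -a aw.
Qed.

Let ev_rev w : all (fun k => k < m)%N w -> ev (rev w) * ev w = 1.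
Proof.
elim: w => [|k w IHw] /=; first by rewrite /ev !big_nil mulr1.
move=> /andP[km wm]; rewrite rev_cons -cats1 ev_cat -(cat1s k w) ev_cat mulrA.
have kk : ev [:: k] * ev [:: k] = 1 by rewrite /ev !big_seq1 g_sq.
by rewrite -(mulrA (ev (rev w))) kk mulr1 IHw.
Qed.

Let act_rev w i : act (rev w) (act w i) = i.
Proof.
elim: w i => // k w IHw i; rewrite rev_cons -cats1 act_cat !act_cons IHw act_nil.
by swap_lia.
Qed.

Let ev_act u v : all (fun k => k < m)%N u -> all (fun k => k < m)%N v ->
  act u =1 act v -> ev u = ev v.
Proof.
move=> um vm uv; have : ev (u ++ rev v) = 1.
  apply: (ev_trivial (leqnn m)) => [|i]; first by rewrite all_cat all_rev um.
  by rewrite act_cat uv act_rev.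
by move/(congr1 ( *%R^~ (ev v))); rewrite ev_cat -mulrA ev_rev // mulr1 mul1r.
Qed.

Lemma coxeter_words (u v : seq 'I_m.+1.-1) :
  (\prod_(k <- u) adj_tperm k)%g = (\prod_(k <- v) adj_tperm k)%g ->
  \prod_(k <- u) g k = \prod_(k <- v) g k.
Proof.
have actE (w : seq 'I_m.+1.-1) i :
    val ((\prod_(k <- w) adj_tperm k)%g i) = act (map val w) (val i).
  elim: w i => [|k w IHw] i; first by rewrite big_nil perm1.
  rewrite big_cons permM IHw map_cons act_cons; congr (act _ _); rewrite /adj_tperm.
  by case: tpermP => [->|->|/eqP + /eqP]; rewrite -?val_eqE /=; swap_lia.
move=> uv; have b (w : seq 'I_m.+1.-1) : all (fun k => k < m)%N (map val w).
  by apply/allP => _ /mapP[k _ ->]; exact: (ltn_ord k).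
have evE (w : seq 'I_m.+1.-1) : \prod_(k <- w) g k = ev (map val w).
  by rewrite /ev big_map.
rewrite !evE; apply: ev_act => // i.
have [im|mi] := leqP i m.
  by have := actE u (Ordinal (im : i < m.+1)%N); rewrite uv actE.
have act_out (w : seq 'I_m.+1.-1) : act (map val w) i = i.
  elim: w => // k w IHw; rewrite map_cons act_cons.
  by have -> : swap (val k) i = i by have := ltn_ord k; rewrite /=; swap_lia.
by rewrite !act_out.
Qed.
End Coxeter.

Section Rho.
Variables (C : numClosedFieldType) (d : nat) (S : 'M[C]_(d ^ 2)).
Hypothesis SR : is_Rmatrix S.

Let words n (u v : seq 'I_n.-1) :
  (\prod_(k <- u) adj_tperm k)%g = (\prod_(k <- v) adj_tperm k)%g ->
  \prod_(k <- u) tens_at n k S = \prod_(k <- v) tens_at n k S.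
Proof.
case: n u v => [|m] u v.
  by case: u => [|[]//]; case: v => [|[]//].
have [_ _ S2 Sb] := SR.
apply: (@coxeter_words _ (fun k => tens_at m.+1 k S)) => [k km|k l kl lm|k km].
- by rewrite -mulmxE -tens_atM // S2 tens_at1.
- by rewrite -mulmxE tens_at_comm.
- by rewrite -mulmxE; exact: tens_at_braid.
Qed.

Lemma rho_adj_tperm n (k : 'I_n.-1) : rho S (adj_tperm k) = tens_at n k S.
Proof. by rewrite /rho (words (v := [:: k])) ?big_seq1 ?adj_wordE. Qed.

Lemma rho_repr n : mx_repr [set: 'S_n] (@rho C d S n).
Proof.
split=> [|s t _ _]; rewrite /rho.
  by rewrite (words (v := [::])) ?big_nil ?adj_wordE.
rewrite mulmxE -big_cat; apply: words.
by rewrite big_cat /= !adj_wordE.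
Qed.

End Rho.

(* Unitary equivalence of rho_S^(n) and rho_S'^(n) for every n >= 1; the
   dimensions of the base spaces are not assumed to agree. *)
Definition YB_equiv {C : numClosedFieldType} {d d' : nat}
    (S : 'M[C]_(d ^ 2)) (S' : 'M[C]_(d' ^ 2)) : Prop :=
  forall n : nat, (0 < n)%N ->
    exists U : 'M[C]_(d' ^ n, d ^ n),
      [/\ U *m U ^t* = 1%:M, U ^t* *m U = 1%:M
        & forall s : 'S_n, U *m rho S s = rho S' s *m U].

Definition YB_char {C : numClosedFieldType} {d : nat} (S : 'M[C]_(d ^ 2))
    (n : nat) (s : 'S_n) : C :=
  (d%:R ^+ n)^-1 * \tr (rho S s).

Definition is_ncycle (n m : nat) (s : 'S_m) : Prop :=
  exists x : 'I_m, #|porbit s x| = n /\ forall y, y \notin porbit s x -> s y = y.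

(* Thoma parameters alpha_1, alpha_2, ... are alpha 0, alpha 1, ...; a character
   of the union of the S_m is given by its restrictions to the S_m. The real
   series below converge because of the bound on the extended-real sums. *)
Record is_Thoma_params {K : realType} (chi : forall m : nat, 'S_m -> K[i])
    (alpha beta : nat -> K) : Prop :=
  IsThomaParams {
    Thoma_alpha_noninc : nonincreasing_seq alpha;
    Thoma_beta_noninc : nonincreasing_seq beta;
    Thoma_alpha_ge0 : forall i, 0 <= alpha i;
    Thoma_beta_ge0 : forall i, 0 <= beta i;
    Thoma_sum_le1 :
      (\sum_(0 <= i <oo) (alpha i)%:E + \sum_(0 <= i <oo) (beta i)%:E <= 1)%E;
    Thoma_cycles : forall (n m : nat) (s : 'S_m), (2 <= n)%N -> is_ncycle n s ->
      chi m s = (limn (series (fun i => alpha i ^+ n))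
                 + (-1) ^+ n.+1 * limn (series (fun i => beta i ^+ n)))%:C%C }.

(* Main.v *)
(* Let X = (id (x) Tr)(R). By the braid relation R (1 (x) X) R and X (x) 1 have the same
   Hilbert-Schmidt norm, and their inner product is its square, so they are equal. Hence
   rho(s) permutes the copies of X on the legs of V^{(x) n}, and tracing out one leg at
   a time expresses Tr rho(s) through the numbers Tr X^m; on an n-cycle it is d^{m-n}
   Tr X^{n-1}, for s in S_m.

   The Temperley-Lieb relations give X^2 + d X + r = 0 and Tr X = 2 r - d^2. So -X has
   as eigenvalues the roots x, y of t^2 - d t + r, with multiplicities x and y; therefore
   d^2 - 4 r = (x - y)^2 is the square of an integer, and Tr X^m is determined by d and
   r. Conversely, for integers x + y = d, x y = r, the projection onto the vectors
   e_a (x) e_b + e_b (x) e_a with a < x <= b is a solution. Representations of a finite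
   group by unitaries with equal characters are unitarily equivalent.

   The power sums of the Thoma parameters thus are those of beta = (x/d, y/d). They
   are the moments of a measure carried by the points -alpha_i and beta_i, which must
   integrate t^2 (t - x/d)^2 (t - y/d)^2 to zero. *)

From HB Require Import structures.
Require Import Defs.
From mathcomp Require Import all_boot all_order all_algebra all_fingroup.
From mathcomp Require Import spectral sesquilinear complex mxtens zify ring lra.
From mathcomp Require Import all_classical all_reals all_analysis.

Set Implicit Arguments.
Unset Strict Implicit.
Unset Printing Implicit Defensive.

Import Order.TTheory GRing.Theory Num.Theory.
Import numFieldNormedType.Exports.

Local Open Scope ring_scope.
Local Open Scope sesquilinear_scope.

(** * Operators on tensor legs *)

Section Fit.
Variable C : numClosedFieldType.

(* The default value 0 makes [fitmx D] linear and multiplicative even when the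
   dimensions do not match. *)
Definition fitmx (D m : nat) (A : 'M[C]_m) : 'M[C]_D := conform_mx 0 A.

Lemma fitmx_id m (A : 'M[C]_m) : fitmx m A = A.
Proof. exact: conform_mx_id. Qed.

Lemma fitmx_neq D m (A : 'M[C]_m) : m != D -> fitmx D A = 0.
Proof. by move=> mD; rewrite /fitmx nonconform_mx ?mD. Qed.

Lemma fitmx_is_linear D m : linear (@fitmx D m).
Proof.
move=> a A B; have [mD|mD] := eqVneq m D.
  by case: D / mD; rewrite !fitmx_id.
by rewrite !fitmx_neq // scaler0 addr0.
Qed.
HB.instance Definition _ D m :=
  GRing.isLinear.Build C 'M[C]_m 'M[C]_D _ (@fitmx D m) (@fitmx_is_linear D m).

Lemma fitmxM D m (A B : 'M[C]_m) : fitmx D (A *m B) = fitmx D A *m fitmx D B.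
Proof.
have [mD|mD] := eqVneq m D; first by case: D / mD; rewrite !fitmx_id.
by rewrite !fitmx_neq // mulmx0.
Qed.

Lemma fitmx1 D m : m = D -> fitmx D (1%:M : 'M[C]_m) = 1%:M.
Proof. by move=> <-; rewrite fitmx_id. Qed.

Lemma mxtrace_fitmx D m (A : 'M[C]_m) : m = D -> \tr (fitmx D A) = \tr A.
Proof. by move=> <-; rewrite fitmx_id. Qed.

(** The two bracketings have different matrix types; [fitmx] absorbs the cast between them, and both
    sides are 0 when [D] is not the common dimension. *)
Lemma fitmx_tensA D m n p (A : 'M[C]_m) (B : 'M[C]_n) (E : 'M[C]_p) :
  fitmx D (A *t (B *t E)) = fitmx D (A *t B *t E).
Proof.
have [mD|mD] := eqVneq (m * n * p)%N D; last first.
  by rewrite !fitmx_neq // mulnA.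
case: D / mD; rewrite fitmx_id /fitmx.
rewrite -(conform_castmx (mulnA m n p, mulnA m n p)) conform_mx_id.
apply/matrixP=> i j; rewrite castmxE.
case: (mxtens_indexP i) => ab c; case: (mxtens_indexP j) => ab' c'.
case: (mxtens_indexP ab) => a b; case: (mxtens_indexP ab') => a' b'.
have E3 (x : 'I_m) (y : 'I_n) (z : 'I_p) :
    cast_ord (esym (mulnA m n p)) (mxtens_index (mxtens_index (x, y), z))
    = mxtens_index (x, mxtens_index (y, z)).
  by apply: val_inj => /=; lia.
by rewrite !E3 !tensmxE mulrA.
Qed.

Lemma fitmx_tensl D m m' n (A : 'M[C]_m) (B : 'M[C]_n) : m = m' ->
  fitmx D (fitmx m' A *t B) = fitmx D (A *t B).
Proof. by move=> <-; rewrite fitmx_id. Qed.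

Lemma fitmx_tensr D m n n' (A : 'M[C]_m) (B : 'M[C]_n) : n = n' ->
  fitmx D (A *t fitmx n' B) = fitmx D (A *t B).
Proof. by move=> <-; rewrite fitmx_id. Qed.

Lemma tensmx11 m n : (1%:M : 'M[C]_m) *t (1%:M : 'M[C]_n) = 1%:M.
Proof.
apply/matrixP=> i j.
case: (mxtens_indexP i) => a b; case: (mxtens_indexP j) => a' b'.
rewrite tensmxE !mxE (can_eq (@mxtens_indexK _ _)) xpair_eqE -mulnb.
by rewrite natrM.
Qed.

Lemma mxtrace_tens m n (A : 'M[C]_m) (B : 'M[C]_n) :
  \tr (A *t B) = \tr A * \tr B.
Proof.
rewrite /mxtrace mulr_sum; apply: eq_bigr => i _.
by case: (mxtens_indexP i) => a b; rewrite tensmxE mxtens_indexK.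
Qed.

Lemma adj_tensmx m n (A : 'M[C]_m) (B : 'M[C]_n) :
  (A *t B) ^t* = A ^t* *t B ^t*.
Proof. by rewrite trmx_tens map_mxT. Qed.

Lemma fitmxE D n (e : D = n) (A : 'M[C]_n) i j :
  fitmx D A i j = A (cast_ord e i) (cast_ord e j).
Proof. by case: n / e A => A; rewrite fitmx_id !cast_ord_id. Qed.

Lemma sum_mxtens_index p n (F : 'I_(p * n) -> C) :
  \sum_j F j = \sum_a \sum_b F (mxtens_index (a, b)).
Proof.
rewrite pair_bigA /= (reindex (@mxtens_index p n)) /=; last first.
  by exists (@mxtens_unindex p n) => z _; rewrite ?mxtens_indexK ?mxtens_unindexK.
by apply: eq_bigr => -[a b].
Qed.

Lemma tens1mx_mulE p n q (A : 'M[C]_n) (Z : 'M[C]_(p * n, q)) i k l :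
  ((1%:M : 'M[C]_p) *t A *m Z) (mxtens_index (i, k)) l =
  \sum_b A k b * Z (mxtens_index (i, b)) l.
Proof.
rewrite mxE sum_mxtens_index (bigD1 i) //= [X in _ + X]big1 ?addr0 => [|a ai].
  by apply: eq_bigr => b _; rewrite tensmxE mxE eqxx mul1r.
by apply: big1 => b _; rewrite tensmxE mxE eq_sym (negPf ai) !mul0r.
Qed.

Lemma mul_tens1mxE p n q (A : 'M[C]_n) (Z : 'M[C]_(q, p * n)) i k l :
  (Z *m ((1%:M : 'M[C]_p) *t A)) l (mxtens_index (i, k)) =
  \sum_b Z l (mxtens_index (i, b)) * A b k.
Proof.
rewrite mxE sum_mxtens_index (bigD1 i) //= [X in _ + X]big1 ?addr0 => [|a ai].
  by apply: eq_bigr => b _; rewrite tensmxE mxE eqxx mul1r.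
by apply: big1 => b _; rewrite tensmxE mxE (negPf ai) mul0r mulr0.
Qed.

Lemma tensmx1_mulE p n q (A : 'M[C]_n) (Z : 'M[C]_(n * p, q)) i k l :
  (A *t (1%:M : 'M[C]_p) *m Z) (mxtens_index (k, i)) l =
  \sum_b A k b * Z (mxtens_index (b, i)) l.
Proof.
rewrite mxE sum_mxtens_index; apply: eq_bigr => b _.
rewrite (bigD1 i) //= big1 ?addr0 => [|a ai].
  by rewrite tensmxE mxE eqxx mulr1.
by rewrite tensmxE mxE eq_sym (negPf ai) mulr0 mul0r.
Qed.

Lemma fitmx_cast D p n (e : p = n) (A : 'M[C]_p) : fitmx D (castmx (e, e) A) = fitmx D A.
Proof. by case: n / e; rewrite castmx_id. Qed.

Lemma fitmx_tens1l D n (A : 'M[C]_n) : fitmx D ((1%:M : 'M[C]_1) *t A) = fitmx D A.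
Proof. by rewrite [_ *t _]tens_scalar1mx fitmx_cast. Qed.

Lemma fitmx_tens1r D n (A : 'M[C]_n) : fitmx D (A *t (1%:M : 'M[C]_1)) = fitmx D A.
Proof. by rewrite tens_mx_scalar scale1r fitmx_cast. Qed.

Lemma adjmxM m n p (A : 'M[C]_(m, n)) (B : 'M[C]_(n, p)) :
  (A *m B) ^t* = B ^t* *m A ^t*.
Proof. by rewrite trmx_mul map_mxM. Qed.

Lemma adjmxB m n (A B : 'M[C]_(m, n)) : (A - B) ^t* = A ^t* - B ^t*.
Proof. by rewrite linearB map_mxB. Qed.

Lemma adjmxD m n (A B : 'M[C]_(m, n)) : (A + B) ^t* = A ^t* + B ^t*.
Proof. by rewrite linearD map_mxD. Qed.

Lemma adjmxZ m n a (A : 'M[C]_(m, n)) : (a *: A) ^t* = a^* *: A ^t*.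
Proof. by rewrite linearZ map_mxZ. Qed.

Lemma adjmx1 n : (1%:M : 'M[C]_n) ^t* = 1%:M.
Proof. by rewrite trmx1 map_mx1. Qed.

End Fit.

Section Legs.
Variables (C : numClosedFieldType) (d : nat).
Implicit Types (A B : 'M[C]_d) (X Y : 'M[C]_(d ^ 2)).

(** Legs count from 0. Going through [fitmx] makes [leg n j] linear and multiplicative for all [n]
    and [j], without the side condition j < n. *)
Definition leg (n j : nat) A : 'M[C]_(d ^ n) :=
  fitmx (d ^ n) ((1%:M : 'M[C]_(d ^ j)) *t A *t (1%:M : 'M[C]_(d ^ (n - j.+1)))).

Lemma leg_is_linear n j : linear (leg n j).
Proof.
move=> a A B; rewrite /leg -linearP; congr fitmx.
by apply/matrixP=> i k; rewrite !mxE mulrDr mulrDl; congr (_ + _); rewrite mulrCA !mulrA.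
Qed.
HB.instance Definition _ n j :=
  GRing.isLinear.Build C 'M[C]_d 'M[C]_(d ^ n) _ (leg n j) (@leg_is_linear n j).

Lemma legM n j A B : leg n j (A *m B) = leg n j A *m leg n j B.
Proof. by rewrite /leg -fitmxM !tensmx_mul !mulmx1. Qed.

Lemma leg1 n j : (j < n)%N -> leg n j 1%:M = 1%:M.
Proof.
by move=> jn; rewrite /leg !tensmx11 fitmx1 // -expnSr -expnD; congr (_ ^ _)%N; lia.
Qed.

Definition lleg A : 'M[C]_(d ^ 2) := A *t (1%:M : 'M[C]_d).
Definition rleg A : 'M[C]_(d ^ 2) := (1%:M : 'M[C]_d) *t A.

Lemma tens_at_fit n k X : (k.+1 < n)%N -> tens_at n k X =
  fitmx (d ^ n) ((1%:M : 'M[C]_(d ^ k)) *t X *t (1%:M : 'M[C]_(d ^ (n - k.+2)))).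
Proof.
move=> kn; have e : (d ^ k * d ^ 2 * d ^ (n - k.+2) = d ^ n)%N.
  by rewrite -!expnD; congr (_ ^ _)%N; lia.
by rewrite /tens_at /fitmx -!(conform_castmx (e, e)) !conform_mx_id.
Qed.

Lemma fitmx_tensAl D m n p q (A : 'M[C]_m) (B : 'M[C]_n) (E : 'M[C]_p) (F : 'M[C]_q) :
  fitmx D (A *t (B *t E) *t F) = fitmx D (A *t B *t (E *t F)).
Proof.
rewrite -(fitmx_tensl _ _ _ (mulnA m n p)) fitmx_tensA fitmx_tensl //.
by rewrite fitmx_tensA.
Qed.

Lemma tens_at_lleg n k A : (k.+1 < n)%N -> tens_at n k (lleg A) = leg n k A.
Proof.
move=> kn; rewrite tens_at_fit // fitmx_tensAl tensmx11 /leg.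
have e : (d * d ^ (n - k.+2) = d ^ (n - k.+1))%N.
  by rewrite -expnS; congr (_ ^ _)%N; lia.
by rewrite -(fitmx_tensr _ _ _ e) fitmx1.
Qed.

Lemma tens_at_rleg n k A : (k.+1 < n)%N -> tens_at n k (rleg A) = leg n k.+1 A.
Proof.
move=> kn; rewrite tens_at_fit // fitmx_tensAl tensmx11 /leg.
by rewrite fitmx_tensA -{1}(fitmx_id (1%:M *t A)) -expnSr fitmx_id.
Qed.

End Legs.

(** * Partial traces *)

Section Commutation.
Variables (C : numClosedFieldType) (d : nat).
Implicit Types (A B : 'M[C]_d) (X Y : 'M[C]_(d ^ 2)).

Lemma fitmx_comm D m n (A : 'M[C]_m) (B : 'M[C]_n) :
  fitmx D (A *t (1%:M : 'M[C]_n)) *m fitmx D ((1%:M : 'M[C]_m) *t B) =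
  fitmx D ((1%:M : 'M[C]_m) *t B) *m fitmx D (A *t (1%:M : 'M[C]_n)).
Proof. by rewrite -!fitmxM !tensmx_mul !mulmx1 !mul1mx. Qed.

(** Cuts the tensor product before leg [k]; operators on opposite sides of such a cut commute by
    [fitmx_comm]. *)
Lemma leg_left n k j A : (j < k <= n)%N -> leg n j A =
  fitmx (d ^ n) (leg k j A *t (1%:M : 'M[C]_(d ^ (n - k)))).
Proof.
move=> jkn; rewrite /leg fitmx_tensl; last first.
  by rewrite -expnSr -expnD; congr (_ ^ _)%N; lia.
rewrite -[RHS]fitmx_tensA tensmx11.
have e : (d ^ (k - j.+1) * d ^ (n - k) = d ^ (n - j.+1))%N.
  by rewrite -expnD; congr (_ ^ _)%N; lia.
by rewrite -(fitmx_tensr _ _ _ e) fitmx1.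
Qed.

Lemma leg_right n k j A : (k <= j < n)%N -> leg n j A =
  fitmx (d ^ n) ((1%:M : 'M[C]_(d ^ k)) *t leg (n - k) (j - k) A).
Proof.
move=> kjn; rewrite /leg fitmx_tensr; last first.
  by rewrite -expnSr -expnD; congr (_ ^ _)%N; lia.
have -> : (n - k - (j - k).+1 = n - j.+1)%N by lia.
have e : (d ^ k * d ^ (j - k) = d ^ j)%N by rewrite -expnD; congr (_ ^ _)%N; lia.
apply/esym; rewrite fitmx_tensA -(fitmx_tensl _ _ _ (mulnA _ _ _)) fitmx_tensA.
by rewrite fitmx_tensl // tensmx11 e.
Qed.

Lemma tens_at_left n k X : (k.+1 < n)%N -> tens_at n k X =
  fitmx (d ^ n) (fitmx (d ^ k.+2) ((1%:M : 'M[C]_(d ^ k)) *t X)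
                 *t (1%:M : 'M[C]_(d ^ (n - k.+2)))).
Proof.
by move=> kn; rewrite tens_at_fit // fitmx_tensl // -expnD addn2.
Qed.

Lemma tens_at_right n k X : (k.+1 < n)%N -> tens_at n k X =
  fitmx (d ^ n) ((1%:M : 'M[C]_(d ^ k))
                 *t fitmx (d ^ (n - k)) (X *t (1%:M : 'M[C]_(d ^ (n - k.+2))))).
Proof.
move=> kn; rewrite tens_at_fit // -fitmx_tensA fitmx_tensr // -expnD.
by congr (_ ^ _)%N; lia.
Qed.

Lemma leg_comm n j k A B : (j < n)%N -> (k < n)%N -> j != k ->
  leg n j A *m leg n k B = leg n k B *m leg n j A.
Proof.
wlog jk : j k A B / (j < k)%N => [H jn kn njk | jn kn _].
  case: (ltngtP j k) => [jk|kj|E]; [exact: H | | by rewrite E eqxx in njk].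
  by apply/esym/H; rewrite // eq_sym.
rewrite (@leg_left n k j) ?jk ?(ltnW kn) // (@leg_right n k k) ?leqnn //.
exact: fitmx_comm.
Qed.

Lemma leg_tens_at_comm n j k A X : (j < n)%N -> (k.+1 < n)%N ->
  j != k -> j != k.+1 ->
  leg n j A *m tens_at n k X = tens_at n k X *m leg n j A.
Proof.
move=> jn kn njk njk1; case: (ltnP j k) => jk.
  rewrite (@leg_left n k j) ?jk ?(ltnW (ltnW kn)) // tens_at_right //.
  exact: fitmx_comm.
rewrite (@leg_right n k.+2 j) ?tens_at_left //; last by lia.
by rewrite fitmx_comm.
Qed.

Lemma tens_at_sum n k (I : finType) (F : I -> 'M[C]_(d ^ 2)) : (k.+1 < n)%N ->
  tens_at n k (\sum_i F i) = \sum_i tens_at n k (F i).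
Proof.
move=> kn; apply: (big_morph (tens_at n k)) => [X Y|]; first exact: tens_atD.
by rewrite -(scale0r 0) tens_atZ // scale0r.
Qed.

Lemma mxtrace_tens_at n k X : (k.+1 < n)%N ->
  \tr (tens_at n k X) = (d ^ (n - 2))%:R * \tr X.
Proof.
move=> kn; rewrite tens_at_fit // mxtrace_fitmx; last first.
  by rewrite -!expnD; congr (_ ^ _)%N; lia.
rewrite !mxtrace_tens !mxtrace1 mulrAC -natrM -expnD.
by congr (_ %:R * _); congr (_ ^ _)%N; lia.
Qed.

Lemma mxtrace_adj_eq0 m (A : 'M[C]_m) : \tr (A *m A ^t*) = 0 -> A = 0.
Proof.
move=> A0; apply/matrixP=> i j; rewrite mxE.
have E : \tr (A *m A ^t*) = \sum_i \sum_j `|A i j| ^+ 2.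
  by apply: eq_bigr => k _; rewrite mxE; apply: eq_bigr => l _; rewrite !mxE normCK.
have ge0 k l : 0 <= `|A k l| ^+ 2 by rewrite exprn_ge0.
move: A0; rewrite E => /eqP; rewrite psumr_eq0; last by move=> *; apply: sumr_ge0.
move=> /allP/(_ i (mem_index_enum _)) /=; rewrite psumr_eq0 //.
by move=> /allP/(_ j (mem_index_enum _)) /=; rewrite expf_eq0 normr_eq0 => /eqP.
Qed.

(** Embedding multiplies the squared Hilbert-Schmidt norm, the trace of [X *m X ^t*], by a nonzero
    power of d. *)
Lemma tens_at_eq0 n k X : (0 < d)%N -> (k.+1 < n)%N -> tens_at n k X = 0 -> X = 0.
Proof.
move=> d0 kn X0; apply: mxtrace_adj_eq0; apply/eqP.
have : \tr (tens_at n k (X *m X ^t*)) = 0 by rewrite tens_atM // X0 mul0mx mxtrace0.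
rewrite mxtrace_tens_at // => /eqP; rewrite mulf_eq0 pnatr_eq0.
by rewrite -leqn0 leqNgt expn_gt0 d0.
Qed.

End Commutation.

Section CondExp.
Variables (C : numClosedFieldType) (d D : nat).
Variable L : {linear 'M[C]_d -> 'M[C]_D}.
Hypothesis LM : forall A B, L (A *m B) = L A *m L B.
Hypothesis L1 : L 1%:M = 1%:M.

Let sum_delta1 : \sum_i delta_mx i i = 1%:M :> 'M[C]_d.
Proof. by rewrite scalar_mx_sum_delta; under [RHS]eq_bigr => i _ do rewrite scale1r. Qed.

(** An unnormalised conditional expectation onto the commutant of the image of [L]. When [L] embeds
    a leg, it traces out that leg and puts the identity there. *)
Definition condexp (M : 'M[C]_D) : 'M[C]_D :=
  \sum_a \sum_b L (delta_mx a b) *m M *m L (delta_mx b a).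

Lemma sum_image_delta : \sum_a \sum_b L (delta_mx b a) *m L (delta_mx a b) = d%:R%:M.
Proof.
under eq_bigr => a _ do under eq_bigr => b _ do rewrite -LM mul_delta_mx.
under eq_bigr => a _ do rewrite -linear_sum /=.
under eq_bigr => a _.
  rewrite sum_delta1 L1; over.
by rewrite sumr_const card_ord -scaler_nat scale_scalar_mx mulr1.
Qed.

Lemma condexp1 : condexp 1%:M = d%:R%:M.
Proof.
rewrite -sum_image_delta [RHS]exchange_big; apply: eq_bigr => a _.
by apply: eq_bigr => b _; rewrite mulmx1.
Qed.

Definition comm_image (Z : 'M[C]_D) := forall A, L A *m Z = Z *m L A.

Lemma comm_imageM Z Z' : comm_image Z -> comm_image Z' -> comm_image (Z *m Z').
Proof. by move=> ZL ZL' A; rewrite mulmxA ZL -mulmxA ZL' mulmxA. Qed.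

Lemma condexpMl Z M : comm_image Z -> condexp (Z *m M) = Z *m condexp M.
Proof.
move=> ZL; rewrite /condexp mulmx_sumr; apply: eq_bigr => a _.
by rewrite mulmx_sumr; apply: eq_bigr => b _; rewrite !mulmxA ZL.
Qed.

Lemma condexpMr Z M : comm_image Z -> condexp (M *m Z) = condexp M *m Z.
Proof.
move=> ZL; rewrite /condexp mulmx_suml; apply: eq_bigr => a _.
by rewrite mulmx_suml; apply: eq_bigr => b _; rewrite -!mulmxA ZL.
Qed.

Lemma condexp_comm Z : comm_image Z -> condexp Z = d%:R *: Z.
Proof.
by move=> ZL; rewrite -{1}(mulmx1 Z) condexpMl // condexp1 mul_mx_scalar.
Qed.

(** Once [Z] is pulled inside, cyclicity of the trace brings the matrix units together, and their
    products sum to d. *)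
Lemma mxtrace_condexp M Z : comm_image Z ->
  \tr (condexp M *m Z) = d%:R * \tr (M *m Z).
Proof.
move=> ZL; rewrite -condexpMr // -mxtraceZ -mul_scalar_mx -sum_image_delta.
rewrite mulmx_suml !raddf_sum; apply: eq_bigr => a _.
rewrite mulmx_suml !raddf_sum; apply: eq_bigr => b _ /=.
by rewrite [LHS]mxtrace_mulC !mulmxA.
Qed.

Lemma condexp_image A : condexp (L A) = (\tr A)%:M.
Proof.
have E a b : delta_mx a b *m A *m delta_mx b a = A b b *: delta_mx a a.
  (* Each matrix unit factors as a column times a row, so the middle of the product becomes the 1 by
     1 matrix with entry [A b b]. *)
  rewrite -(mul_delta_mx (0 : 'I_1) a b) -(mul_delta_mx (0 : 'I_1) b a).
  rewrite !mulmxA -(mulmxA (delta_mx a 0) _ A) -rowE -(mulmxA (delta_mx a 0)) -colE.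
  by rewrite (mx11_scalar (col _ _)) !mxE mul_mx_scalar -scalemxAl mul_delta_mx.
rewrite /condexp; under eq_bigr => a _ do under eq_bigr => b _ do rewrite -!LM E linearZ /=.
rewrite exchange_big /=; under eq_bigr => b _ do rewrite -scaler_sumr -linear_sum /=.
by rewrite sum_delta1 L1 -scaler_suml scalemx1.
Qed.

(** An operator commuting with the leg acts on the other legs only, so the trace factorises. *)
Lemma mxtrace_image A Z : comm_image Z ->
  d%:R * \tr (L A *m Z) = \tr A * \tr Z.
Proof.
by move=> ZL; rewrite -mxtrace_condexp // condexp_image mul_scalar_mx mxtraceZ.
Qed.

End CondExp.

Section PartialTrace.
Variables (C : numClosedFieldType) (d : nat).
Implicit Types (A B : 'M[C]_d) (X Y M : 'M[C]_(d ^ 2)).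

(** The map id (x) Tr, which traces out the right leg. The annotation needs no cast because d ^ 2
    unfolds to d * d. *)
Definition ptr M : 'M[C]_d :=
  \matrix_(i, j) \sum_k (M : 'M[C]_(d * d)) (mxtens_index (i, k)) (mxtens_index (j, k)).

Lemma ptr_is_linear : linear ptr.
Proof.
move=> a X Y; apply/matrixP=> i j; rewrite !mxE mulr_sumr -big_split.
by apply: eq_bigr => k _; rewrite !mxE.
Qed.
HB.instance Definition _ :=
  GRing.isLinear.Build C 'M[C]_(d ^ 2) 'M[C]_d _ ptr ptr_is_linear.

Lemma llegM A B : lleg (A *m B) = lleg A *m lleg B.
Proof. by rewrite /lleg tensmx_mul mulmx1. Qed.

Lemma rlegM A B : rleg (A *m B) = rleg A *m rleg B.
Proof. by rewrite /rleg tensmx_mul mulmx1. Qed.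

Lemma lrleg_comm A B : lleg A *m rleg B = rleg B *m lleg A.
Proof. by rewrite !tensmx_mul !mulmx1 !mul1mx. Qed.

Lemma lleg1 : lleg 1%:M = 1%:M :> 'M[C]_(d ^ 2). Proof. exact: tensmx11. Qed.
Lemma rleg1 : rleg 1%:M = 1%:M :> 'M[C]_(d ^ 2). Proof. exact: tensmx11. Qed.

Lemma rleg_is_linear : linear (@rleg C d).
Proof. by move=> a A B; apply/matrixP=> i j; rewrite !mxE mulrDr mulrCA. Qed.
HB.instance Definition _ :=
  GRing.isLinear.Build C 'M[C]_d 'M[C]_(d ^ 2) _ (@rleg C d) rleg_is_linear.

Lemma lleg_is_linear : linear (@lleg C d).
Proof. by move=> a A B; apply/matrixP=> i j; rewrite !mxE mulrDl mulrA. Qed.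
HB.instance Definition _ :=
  GRing.isLinear.Build C 'M[C]_d 'M[C]_(d ^ 2) _ (@lleg C d) lleg_is_linear.

Let rleg_mulE A M i k j : (rleg A *m M : 'M[C]_(d * d)) (mxtens_index (i, k)) j =
  \sum_b A k b * (M : 'M[C]_(d * d)) (mxtens_index (i, b)) j.
Proof. exact: tens1mx_mulE. Qed.

Let mul_rlegE A M i k j : (M *m rleg A : 'M[C]_(d * d)) j (mxtens_index (i, k)) =
  \sum_b (M : 'M[C]_(d * d)) j (mxtens_index (i, b)) * A b k.
Proof. exact: mul_tens1mxE. Qed.

(** Links the entrywise partial trace with the average over matrix units, so that properties of
    [ptr] can be read off from those of [condexp]. *)
Lemma condexp_rleg M : condexp (@rleg C d) M = lleg (ptr M).
Proof.
apply/matrixP=> i j; case: (mxtens_indexP i) => i1 i2; case: (mxtens_indexP j) => j1 j2.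
rewrite tensmxE !mxE summxE mulr_suml.
rewrite (bigD1 i2) //= [X in _ + X]big1 ?addr0; last first.
  move=> a ai; rewrite summxE big1 // => b _; rewrite -mulmxA rleg_mulE big1 // => c _.
  by rewrite mxE eq_sym (negPf ai) mul0r.
rewrite summxE; apply: eq_bigr => b _; rewrite mul_rlegE (bigD1 b) //= big1 ?addr0.
  rewrite rleg_mulE (bigD1 b) //= big1 ?addr0.
    by rewrite !mxE !eqxx mul1r [j2 == _]eq_sym.
  by move=> c cb; rewrite mxE (negPf cb) andbF mul0r.
by move=> c cb; rewrite [X in _ * X]mxE (negPf cb) mulr0.
Qed.

Lemma condexp_leg_tens_at n k M : (k.+1 < n)%N ->
  condexp (leg n k.+1) (tens_at n k M) = leg n k (ptr M).
Proof.
move=> kn; rewrite -(@tens_at_lleg C d n) // -condexp_rleg tens_at_sum //.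
apply: eq_bigr => a _; rewrite tens_at_sum //; apply: eq_bigr => b _.
by rewrite !tens_atM // !tens_at_rleg.
Qed.

End PartialTrace.

(** * The partial trace of an R-matrix *)

(** In the rank factorisation of [P] into [col_base P] and [row_base P], idempotence makes the
    product in the other order an identity matrix, whose size is the rank. *)
Lemma mxtrace_idem (F : fieldType) n (P : 'M[F]_n) :
  P *m P = P -> \tr P = (\rank P)%:R.
Proof.
move=> PP; have : row_base P *m col_base P = 1%:M.
  apply: (row_full_inj (col_base_full P)); apply: (row_free_inj (row_base_free P)).
  by rewrite mulmx1 mulmxA mulmx_base -mulmxA mulmx_base PP.
have -> : \tr P = \tr (row_base P *m col_base P) by rewrite mxtrace_mulC mulmx_base.
by move=> ->; rewrite mxtrace1.
Qed.

Section PtrTheory.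
Variables (C : numClosedFieldType) (d : nat).
Hypothesis d0 : (0 < d)%N.
Implicit Types (A B : 'M[C]_d) (X Y M : 'M[C]_(d ^ 2)).

Let dn0 : d%:R != 0 :> C. Proof. by rewrite pnatr_eq0 -lt0n. Qed.

Lemma ptr_lleg A : ptr (lleg A) = d%:R *: A.
Proof.
apply/matrixP=> i j; rewrite !mxE; under eq_bigr => k _ do rewrite tensmxE mxE eqxx mulr1.
by rewrite sumr_const card_ord mulr_natl.
Qed.

Lemma ptr_rleg A : ptr (rleg A) = (\tr A)%:M.
Proof.
apply/matrixP=> i j; rewrite !mxE; under eq_bigr => k _ do rewrite tensmxE mxE.
by rewrite -mulr_sumr mulr_natl.
Qed.

Lemma ptr1 : ptr (1%:M : 'M[C]_(d ^ 2)) = d%:R%:M.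
Proof. by rewrite -lleg1 ptr_lleg scalemx1. Qed.

Lemma lleg_inj : injective (@lleg C d).
Proof.
by move=> A B /(congr1 (@ptr C d)); rewrite !ptr_lleg; apply: scalerI.
Qed.

Lemma ptr_llegl A M : ptr (lleg A *m M) = A *m ptr M.
Proof.
apply: lleg_inj; rewrite llegM -!condexp_rleg condexpMl // => B.
by rewrite -lrleg_comm.
Qed.

Lemma ptr_llegr A M : ptr (M *m lleg A) = ptr M *m A.
Proof.
apply: lleg_inj; rewrite llegM -!condexp_rleg condexpMr // => B.
by rewrite -lrleg_comm.
Qed.

Lemma mxtrace_ptr M : \tr (ptr M) = \tr M.
Proof.
apply: (mulIf dn0); rewrite mulrC -mxtraceZ -[RHS]mulrC.
have := mxtrace_condexp (@rlegM C d) (@rleg1 C d) M (Z := 1%:M).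
rewrite !mulmx1 => <-; last by move=> A; rewrite mulmx1 mul1mx.
by rewrite condexp_rleg mxtrace_tens mxtrace1 mulrC mxtraceZ.
Qed.

Lemma mxtrace_leg n j A : (j < n)%N ->
  d%:R * \tr (leg n j A) = (d ^ n)%:R * \tr A.
Proof.
move=> jn; rewrite mulrC -(mulmx1 (leg n j A)) [LHS]mulrC.
rewrite (mxtrace_image (@legM C d n j) (leg1 C d jn)) ?mxtrace1 1?mulrC //.
by move=> B; rewrite mulmx1 mul1mx.
Qed.

Lemma ptr_adj M : ptr (M ^t*) = (ptr M) ^t*.
Proof.
by apply/matrixP=> i j; rewrite !mxE rmorph_sum; apply: eq_bigr => k _; rewrite !mxE.
Qed.

(** Conjugation by [S] turns [rleg Z] into [lleg Z], so every term of the expanded last hypothesis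
    has a partial trace expressible by [Z] and traces. Their sum is a quadratic equation. *)
Lemma ptr_relation (S : 'M[C]_(d ^ 2)) : let Z := ptr S in S *m S = 1%:M ->
  S *m rleg Z *m S = lleg Z ->
  (S + 1%:M) *m rleg Z *m (S + 1%:M) = - (d%:R *: (S + 1%:M)) ->
  2 *: (Z *m Z) = - ((2 * d%:R) *: Z) - (d%:R ^+ 2 + \tr S)%:M.
Proof.
move=> Z SS lZ; have Sr : S *m rleg Z = lleg Z *m S by rewrite -lZ -mulmxA SS mulmx1.
have rS : rleg Z *m S = S *m lleg Z by rewrite -lZ !mulmxA SS mul1mx.
have -> M : (S + 1%:M) *m M *m (S + 1%:M) = S *m M *m S + S *m M + M *m S + M.
  by rewrite mulmxDl mul1mx mulmxDr mulmx1 mulmxDl -!addrA; congr (_ + _); rewrite addrCA.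
rewrite lZ Sr rS => /(congr1 (@ptr C d)).
rewrite linearN linearZ !linearD /= ptr_llegl ptr_llegr ptr_lleg ptr_rleg ptr1.
rewrite mxtrace_ptr -/Z => E.
have -> : 2 *: (Z *m Z) = d%:R *: Z + Z *m Z + Z *m Z + (\tr S)%:M
                          - d%:R *: Z - (\tr S)%:M.
  by apply/matrixP=> i j; rewrite !mxE; ring.
rewrite E; apply/matrixP=> i j; rewrite !mxE.
by case: (i == j); rewrite ?mulr1n ?mulr0n; ring.
Qed.

End PtrTheory.

Section Rmatrix.
Variables (C : numClosedFieldType) (d : nat) (R : 'M[C]_(d ^ 2)).
Hypothesis SR : is_Rmatrix R.

Let d0 : (0 < d)%N := Rmatrix_dim SR.
Let dn0 : d%:R != 0 :> C. Proof. by rewrite pnatr_eq0 -lt0n. Qed.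
Let RR : R *m R = 1%:M := Rmatrix_invol SR.

Lemma Rmatrix_herm : R ^t* = R.
Proof.
have /unitarymxP RU := Rmatrix_unitary SR.
by rewrite -[LHS]mul1mx -RR -mulmxA RU mulmx1.
Qed.

Let X := ptr R.

(* Both sides have the same Hilbert-Schmidt norm, and by the braid relation their
   inner product is that norm squared. *)
Lemma conj_rleg : R *m rleg X *m R = lleg X.
Proof.
pose a := tens_at 3 0 R; pose b := tens_at 3 1 R; pose x k := leg 3 k X.
have aa : a *m a = 1%:M by rewrite -tens_atM // RR tens_at1.
have bb : b *m b = 1%:M by rewrite -tens_atM // RR tens_at1.
have aba : a *m b *m a = b *m a *m b := Rmatrix_braid SR.
have bx : b *m x 0%N = x 0%N *m b by rewrite /b /x leg_tens_at_comm.
have trx : \tr (x 1%N *m x 1%N) = \tr (x 0%N *m x 0%N).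
  by apply: (mulfI dn0); rewrite -!legM !mxtrace_leg.
(* The braid relation enters here: [x 1] is [b] with the third leg traced out, so a b a becomes b a
   b. The two factors [b] cancel, since [b] commutes with [x 0], and tracing out the second leg
   turns the remaining [a] into [x 0]. *)
have ax : \tr (a *m x 1%N *m a *m x 0%N) = \tr (x 0%N *m x 0%N).
  have ca : comm_image (leg 3 2) a by move=> A; rewrite leg_tens_at_comm.
  have c2 : comm_image (leg 3 2) (x 0%N) by move=> A; rewrite leg_comm.
  have c1 : comm_image (leg 3 1) (x 0%N) by move=> A; rewrite leg_comm.
  have l1 k : (k < 3)%N -> leg 3 k 1%:M = 1%:M :> 'M[C]_(d ^ 3) by exact: leg1.
  rewrite {1}/x -(condexp_leg_tens_at (n := 3) (k := 1)) // -/b.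
  rewrite -condexpMl // -condexpMr // aba.
  rewrite (mxtrace_condexp (@legM C d 3 2) (l1 2 isT)) //.
  rewrite -mulmxA bx mulmxA mxtrace_mulC !mulmxA bb mul1mx.
  rewrite -(mxtrace_condexp (@legM C d 3 1) (l1 1 isT)) //.
  by rewrite condexp_leg_tens_at.
apply/eqP; rewrite -subr_eq0; apply/eqP; set T := _ - _.
have Ta : T ^t* = T.
  rewrite adjmxB !adjmxM Rmatrix_herm [(rleg X) ^t*]adj_tensmx [(lleg X) ^t*]adj_tensmx.
  by rewrite !adjmx1 -ptr_adj Rmatrix_herm mulmxA.
apply: mxtrace_adj_eq0; rewrite Ta; apply: (mulfI dn0); rewrite mulr0.
have <- : \tr (tens_at 3 0 (T *m T)) = d%:R * \tr (T *m T) by rewrite mxtrace_tens_at.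
have TE : tens_at 3 0 T = a *m x 1%N *m a - x 0%N.
  by rewrite /T -scaleN1r tens_atD // tens_atZ // !tens_atM // tens_at_rleg //
    tens_at_lleg // scaleN1r.
rewrite tens_atM // TE mulmxBr !mulmxBl !raddfB /= ax.
rewrite (mxtrace_mulC (x 0%N)) ax.
rewrite mulmxA mxtrace_mulC !mulmxA aa mul1mx -!mulmxA (mulmxA a a) aa mul1mx trx.
by rewrite subrr opprK addNr addr0.
Qed.

Lemma tens_at_rlegX n k : (k.+1 < n)%N ->
  tens_at n k R *m leg n k.+1 X = leg n k X *m tens_at n k R.
Proof.
move=> kn; rewrite -!tens_at_rleg // -!tens_at_lleg // -!tens_atM // -conj_rleg.
by rewrite -!mulmxA RR mulmx1.
Qed.

Lemma tens_at_llegX n k : (k.+1 < n)%N ->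
  tens_at n k R *m leg n k X = leg n k.+1 X *m tens_at n k R.
Proof.
move=> kn; rewrite -!tens_at_rleg // -!tens_at_lleg // -!tens_atM // -conj_rleg.
by rewrite !mulmxA RR mul1mx.
Qed.

End Rmatrix.

Section TemperleyLieb.
Variables (C : numClosedFieldType) (d r : nat) (P : 'M[C]_(d ^ 2)).
Hypothesis HP : is_YBrep_TL2 r P.

Let d0 : (0 < d)%N := YBrep_dim HP.
Let dn0 : d%:R != 0 :> C. Proof. by rewrite pnatr_eq0 -lt0n. Qed.
Let PP : P *m P = P := YBrep_idem HP.
Let R := Rmatrix_of P.
Let RR : R *m R = 1%:M := Rmatrix_invol (Rmatrix_of_is_Rmatrix HP).
Let X := ptr R.

Lemma mxtrace_Rmatrix_of : \tr R = 2 * r%:R - d%:R ^+ 2.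
Proof.
by rewrite raddfB /= mxtraceZ mxtrace1 mxtrace_idem // (YBrep_rank HP) natrX.
Qed.

(** This is P_1 P_2 P_1 = P_1 / 4 with the third leg traced out: P_1 commutes with that leg, P_2
    contributes [ptr P], and the identity on the leg contributes d. *)
Lemma TL_rleg_ptr : P *m rleg (ptr P) *m P = (d%:R / 4) *: P.
Proof.
apply/eqP; rewrite -subr_eq0; apply/eqP; apply: (@tens_at_eq0 C d 3 0) => //.
have [TL _] := YBrep_TL HP.
have c (P' : 'M[C]_(d ^ 2)) : comm_image (leg 3 2) (tens_at 3 0 P').
  by move=> A; rewrite leg_tens_at_comm.
rewrite -scaleN1r tens_atD // !tens_atZ // !tens_atM // tens_at_rleg //.
rewrite -(condexp_leg_tens_at (n := 3) (k := 1)) // -condexpMl // -condexpMr // TL.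
rewrite -tens_atZ // (condexp_comm (@legM C d 3 2) (@leg1 C d 3 2 isT)) //.
  by rewrite tens_atZ // !scalerA -scalerDl mulN1r subrr scale0r.
by move=> A; rewrite -scalemxAl -scalemxAr c.
Qed.

(* [X] is minus a positive operator with eigenvalues the roots of t^2 - d t + r. *)
Lemma ptr_quadratic : X *m X = - (d%:R *: X) - r%:R%:M.
Proof.
have lX : R *m rleg X *m R = lleg X := conj_rleg (Rmatrix_of_is_Rmatrix HP).
have RE : R + 1%:M = 2 *: P by rewrite subrK.
have XE : X = 2 *: ptr P - d%:R%:M by rewrite /X linearB linearZ /= ptr1.
(* With [R + 1%:M] equal to 2 P, the constant is 4 (2 d / 4 - d) = - 2 d in front of P. *)
have : (R + 1%:M) *m rleg X *m (R + 1%:M) = - (d%:R *: (R + 1%:M)).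
  have -> : rleg X = 2 *: rleg (ptr P) - d%:R *: 1%:M.
    by rewrite XE linearB linearZ /= -scalemx1 linearZ /= rleg1.
  rewrite RE.
  rewrite mulmxBr mulmxBl -!(scalemxAl, scalemxAr) mulmx1 PP TL_rleg_ptr !scalerA.
  by apply/matrixP=> i j; rewrite !mxE; field.
move/(ptr_relation d0 RR lX); rewrite mxtrace_Rmatrix_of -/R -/X => E.
apply: (@scalerI _ _ 2); first by rewrite pnatr_eq0.
apply/matrixP=> i j; move/matrixP: E => /(_ i j); rewrite !mxE => ->.
by case: (i == j); rewrite ?mulr1n ?mulr0n; ring.
Qed.

(** A square root [s] of the discriminant is 0 or separates the two eigenvalues of [X]; in the
    second case the trace of an eigenprojection is a natural number and determines [s]. *)
Lemma TL_disc_square : exists k : nat, d%:Z ^+ 2 - 4 * r%:Z = k%:Z ^+ 2.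
Proof.
pose s : C := sqrtC (d%:R ^+ 2 - 4 * r%:R).
have sE : s ^+ 2 = d%:R ^+ 2 - 4 * r%:R := sqrtCK _.
have [z zE] : exists z : int, s ^+ 2 = z%:~R ^+ 2.
  have [->|s0] := eqVneq s 0; first by exists 0; rewrite expr0n.
  (* [- u] is one root of the quadratic equation for [X], and [Q] is the spectral projection to the
     other root, [s - u]. *)
  pose u := (d%:R + s) / 2; pose Q := s^-1 *: (X + u%:M).
  have rE : r%:R = u * (d%:R - u) :> C.
    by apply: (@mulfI _ 4); rewrite ?pnatr_eq0 // -[LHS](subKr (d%:R ^+ 2)) -sE /u; field.
  have QQ : Q *m Q = Q.
    have XX : (X + u%:M) *m (X + u%:M) = s *: (X + u%:M).
      rewrite mulmxDl !mulmxDr ptr_quadratic mul_scalar_mx mul_mx_scalar mul_scalar_mx.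
      apply/matrixP=> i j; rewrite !mxE rE /u.
      by case: (i == j); rewrite ?mulr1n ?mulr0n; field.
    by rewrite /Q -scalemxAl -scalemxAr XX (scalerA _ s) mulVf // scale1r.
  exists (d%:Z - 2 * (\rank Q)%:Z); have := mxtrace_idem QQ.
  rewrite mxtraceZ mxtraceD mxtrace_scalar mxtrace_ptr // mxtrace_Rmatrix_of.
  move=> /(congr1 ( *%R s)); rewrite mulVKf // rE => E.
  suff : s * (s - (d%:R - 2 * (\rank Q)%:R)) = 0.
    by move=> /eqP; rewrite mulf_eq0 (negPf s0) /= subr_eq0 => /eqP ->; rewrite intrB intrM.
  by rewrite mulrBr mulrBr mulrCA -E /u -mulr_natr; field.
exists `|z|%N; apply: (@intr_inj C).
by rewrite abszE -normrX ger0_norm ?sqr_ge0 // intrB intrM !rmorphXn /= -zE sE.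
Qed.

End TemperleyLieb.

(** * Traces of the representations of the symmetric groups *)

(** Induction on the number of moved points: if [k] is moved and [j] is its preimage, multiplying by
    [tperm j k] fixes [k] and moves no new point. In the step [s] fixes [k], so leg [k] can be split
    off. *)
Lemma perm_tperm_ind (T : finType) (Q : {perm T} -> Prop) : Q 1%g ->
  (forall (j k : T) (s : {perm T}), j != k -> s k = k -> Q s -> Q (tperm j k * s)%g) ->
  forall s, Q s.
Proof.
move=> Q1 QM s; have [m] := ubnP #|[set x | s x != x]|.
elim: m s => // m IHm s; rewrite ltnS => sm.
have [/forallP s1|] := boolP [forall x, s x == x].
  by have -> : s = 1%g by apply/permP=> x; rewrite perm1; apply/eqP.
rewrite negb_forall => /existsP[k sk]; pose j := (s^-1)%g k.
have sj : s j = k by rewrite permKV.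
have jk : j != k by apply: contraNneq sk => {1}<-; rewrite sj.
have -> : s = (tperm j k * (tperm j k * s))%g by rewrite mulgA tperm2 mul1g.
apply: QM => //; first by rewrite permM tpermR.
apply: IHm; apply: leq_trans sm; apply: proper_card; apply/properP; split.
  apply/fintype.subsetP=> x; rewrite !inE permM; case: tpermP => [->|->|//];
    last by rewrite sj eqxx.
  by rewrite sj [k == j]eq_sym.
by exists k; rewrite inE // permM tpermR sj eqxx.
Qed.

Section Rep.
Variables (C : numClosedFieldType) (d : nat) (R : 'M[C]_(d ^ 2)).
Hypothesis SR : is_Rmatrix R.

Let d0 : (0 < d)%N := Rmatrix_dim SR.
Let dn0 : d%:R != 0 :> C. Proof. by rewrite pnatr_eq0 -lt0n. Qed.
Let X := ptr R.

Lemma rho1 n : rho R (1 : 'S_n)%g = 1%:M.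
Proof. by case: (rho_repr SR n). Qed.

Lemma rhoM n (s t : 'S_n) : rho R (s * t)%g = rho R s *m rho R t.
Proof. by case: (rho_repr SR n) => _ ->; rewrite ?inE. Qed.

Lemma rhoKl n (s : 'S_n) : rho R (s^-1)%g *m rho R s = 1%:M.
Proof. by rewrite -rhoM mulVg rho1. Qed.

Lemma rho_adj n (s : 'S_n) : (rho R s) ^t* = rho R (s^-1)%g.
Proof.
suff : rho R s *m (rho R s) ^t* = 1%:M.
  by move=> H; rewrite -[LHS]mul1mx -(rhoKl s) -mulmxA H mulmx1.
rewrite /rho; elim: (adj_word s) => [|k w IHw]; first by rewrite big_nil adjmx1 mulmx1.
rewrite big_cons -mulmxE; set W := bigop _ _ _ in IHw *.
rewrite adjmxM -mulmxA (mulmxA W) IHw mul1mx.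
have kn := adj_tperm_subproof k.
by rewrite -tens_at_adj // (Rmatrix_herm SR) -tens_atM // (Rmatrix_invol SR) tens_at1.
Qed.

Lemma leg_rho n (i : 'I_n) (s : 'S_n) :
  leg n i X *m rho R s = rho R s *m leg n (s i) X.
Proof.
have -> : s i = (\prod_(k <- adj_word s) adj_tperm k)%g i by rewrite adj_wordE.
rewrite /rho; elim: (adj_word s) i => [|k w IHw] i.
  by rewrite !big_nil mulmx1 mul1mx perm1.
rewrite !big_cons -mulmxE permM mulmxA -[RHS]mulmxA -IHw !mulmxA; congr (_ *m _).
have kn := adj_tperm_subproof k.
rewrite /adj_tperm; case: tpermP => [->|->|/eqP + /eqP] /=.
- by rewrite (tens_at_rlegX SR).
- by rewrite (tens_at_llegX SR).
- by move=> i1 i2; rewrite leg_tens_at_comm.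
Qed.

(** Indices may repeat: a leg listed m times carries X^m. *)
Definition legprod n (s : seq 'I_n) : 'M[C]_(d ^ n) := \prod_(i <- s) leg n i X.

Lemma legprod_rho n (s : seq 'I_n) g :
  legprod s *m rho R g = rho R g *m legprod (map g s).
Proof.
rewrite /legprod; elim: s => [|i s IHs]; first by rewrite !big_nil mulmx1 mul1mx.
by rewrite /= !big_cons -!mulmxE -mulmxA IHs !mulmxA leg_rho.
Qed.

Lemma rho_conj n (s g : 'S_n) (u : seq 'I_n) :
  \tr (rho R (s ^ g)%g *m legprod (map g u)) = \tr (rho R s *m legprod u).
Proof.
rewrite conjgE !rhoM -!mulmxA -legprod_rho mxtrace_mulC -!mulmxA -rhoM mulgV rho1.
by rewrite mulmx1.
Qed.

(** Such a transposition is obtained from adjacent ones avoiding the last leg, by conjugation and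
    induction on the distance of [j] and [k]. *)
Lemma comm_image_rho_tperm m (j k : 'I_m.+1) : j != ord_max -> k != ord_max ->
  j != k -> comm_image (leg m.+1 m) (rho R (tperm j k)).
Proof.
wlog jk : j k / (j < k)%N => [H jm km njk | jm km _].
  case: (ltngtP j k) => [jk|kj|/val_inj E]; [exact: H | | by rewrite E eqxx in njk].
  by rewrite tpermC; apply: H; rewrite // eq_sym.
have [p E] : exists p, (k = j + p.+1 :> nat)%N by exists (k - j.+1)%N; lia.
have {}km : (k < m)%N.
  by rewrite ltn_neqAle -ltnS ltn_ord andbT -[m]/(val (ord_max : 'I_m.+1)) val_eqE.
have adj (i i' : 'I_m.+1) : (i' < m)%N -> i' = i.+1 :> nat ->
    comm_image (leg m.+1 m) (rho R (tperm i i')).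
  move=> i'm ii'; have im : (i < m)%N by lia.
  have -> : tperm i i' = adj_tperm (Ordinal im : 'I_m.+1.-1).
    by congr tperm; apply: val_inj.
  by move=> A; rewrite (rho_adj_tperm SR) leg_tens_at_comm //=; lia.
elim: p k E km {jk jm} => [|p IHp] k E km; first by apply: adj; rewrite // E addn1.
have k'm : (k.-1 < m.+1)%N by lia.
pose k' := Ordinal k'm; have k'k : k = k'.+1 :> nat by rewrite /=; lia.
have -> : tperm j k = (tperm j k' ^ tperm k' k)%g.
  by rewrite tpermJ tpermL tpermD // -val_eqE /=; lia.
rewrite conjgE tpermV !rhoM; do !apply: comm_imageM; try exact: adj.
by apply: IHp; rewrite /=; lia.
Qed.

Lemma comm_image_rho m (s : 'S_m.+1) : s ord_max = ord_max ->
  comm_image (leg m.+1 m) (rho R s).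
Proof.
elim/perm_tperm_ind: s => [_|j k s jk sk IHs].
  by rewrite rho1 => A; rewrite mulmx1 mul1mx.
(* Neither [j] nor [k] is the last index: as the product fixes the last index and [s] fixes [k],
   either case would give j = k. *)
rewrite permM; case: tpermP => [mj sk'|mk sj|/eqP mj /eqP mk sm].
- by case/eqP: jk; rewrite -mj -sk' sk.
- by case/eqP: jk; apply: (@perm_inj _ s); rewrite sj sk.
rewrite rhoM; apply: comm_imageM; last exact: IHs.
by apply: comm_image_rho_tperm; rewrite // eq_sym.
Qed.

Lemma comm_image_legprod n (i : 'I_n) (u : seq 'I_n) : i \notin u ->
  comm_image (leg n i) (legprod u).
Proof.
rewrite /legprod; elim: u => [_ A|j u IHu]; first by rewrite big_nil mulmx1 mul1mx.
rewrite inE negb_or => /andP[ij iu]; rewrite big_cons -mulmxE.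
by apply: comm_imageM => [A|]; [rewrite leg_comm | exact: IHu].
Qed.

(* Conjugating [k] to the last leg, [rho R s *m legprod u] acts trivially there, and
   the partial trace of the last R-matrix is [X] on the leg before. *)
Lemma mxtrace_tperm_rho n (j k : 'I_n) (s : 'S_n) u : j != k -> s k = k -> k \notin u ->
  d%:R * \tr (rho R (tperm j k * s)%g *m legprod u)
  = \tr (rho R s *m legprod (rcons u j)).
Proof.
case: n j k s u => [[]//|[|m]] j k s u jk sk ku.
  by rewrite (ord1 j) (ord1 k) in jk.
pose l : 'I_m.+2 := ord_max; pose l' : 'I_m.+2 := inord m.
have l'E : l' = m :> nat by rewrite inordK.
pose g1 := tperm k l; pose g := (g1 * tperm (g1 j) l')%g.
have gk : g k = l.
  have g1k : g1 k = l by rewrite /g1 tpermL.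
  rewrite permM g1k tpermD //; first by rewrite -g1k (inj_eq perm_inj).
  by apply/eqP => /(congr1 (@nat_of_ord _)); rewrite l'E /=; lia.
have gj : g j = l' by rewrite permM tpermL.
rewrite -[in LHS](rho_conj _ g) -[in RHS](rho_conj _ g) conjMg tpermJ gj gk map_rcons gj.
have sl : (s ^ g)%g l = l by rewrite -gk permJ sk.
have lu : l \notin map g u by rewrite -gk mem_map //; exact: perm_inj.
have cZ : comm_image (leg m.+2 m.+1) (rho R (s ^ g)%g *m legprod (map g u)).
  by apply: comm_imageM; [exact: comm_image_rho | exact: (comm_image_legprod lu)].
have -> : tperm l' l = adj_tperm (ord_max : 'I_m.+2.-1).
  by congr tperm; apply: val_inj.
rewrite rhoM (rho_adj_tperm SR) -mulmxA.
rewrite -(mxtrace_condexp (@legM C d m.+2 m.+1) (leg1 C d (ltnSn m.+1))) //.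
rewrite condexp_leg_tens_at //= mxtrace_mulC -mulmxA /legprod -cats1 big_cat big_seq1.
by rewrite -mulmxE l'E.
Qed.

End Rep.

Section Traces.
Variables (C : numClosedFieldType) (d : nat) (R : 'M[C]_(d ^ 2)).
Hypothesis SR : is_Rmatrix R.

Let X := ptr R.

Lemma legX_comm n (i j : 'I_n) : leg n i X *m leg n j X = leg n j X *m leg n i X.
Proof. by have [->//|ij] := eqVneq i j; rewrite leg_comm. Qed.

Lemma legprod_cons n (i : 'I_n) u : legprod R (i :: u) = leg n i X *m legprod R u.
Proof. by rewrite /legprod big_cons. Qed.

Lemma legprod_insert n (i : 'I_n) u v :
  legprod R (u ++ i :: v) = leg n i X *m legprod R (u ++ v).
Proof.
elim: u => [|j u IHu]; first exact: legprod_cons.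
by rewrite !legprod_cons IHu !mulmxA legX_comm.
Qed.

Lemma legprod_split n (i : 'I_n) u :
  legprod R u = leg n i (X ^+ count_mem i u) *m legprod R [seq j <- u | j != i].
Proof.
elim: u => [|j u IHu]; first by rewrite expr0 leg1 // mul1mx.
rewrite legprod_cons IHu /=; have [->|ji] /= := eqVneq j i.
  by rewrite exprS -mulmxE legM mulmxA.
by rewrite legprod_cons !mulmxA leg_comm.
Qed.

(** The legs in [e] are split off one by one with [mxtrace_image]. A leg of [e] outside [u]
    contributes Tr X^0 = d. *)
Lemma mxtrace_legprod n (e u : seq 'I_n) : uniq e -> {subset u <= e} ->
  d%:R ^+ size e * \tr (legprod R u) =
  d%:R ^+ n * \prod_(i <- e) \tr (X ^+ count_mem i u).
Proof.
elim: e u => [|i e IHe] u /=.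
  case: u => [_ _|j u _ /(_ j (mem_head _ _))//].
  by rewrite /legprod !big_nil mul1r mulr1 mxtrace1 natrX.
move=> /andP[ie ue] sue; set v := [seq j <- u | j != i].
have iv : i \notin v by rewrite mem_filter eqxx.
rewrite (legprod_split i u) exprSr -mulrA.
rewrite (mxtrace_image (@legM C d n i) (leg1 C d (ltn_ord i))); last first.
  exact: comm_image_legprod.
rewrite mulrCA IHe //; last first.
  by move=> j; rewrite mem_filter => /andP[ji /sue]; rewrite inE (negPf ji).
rewrite big_cons mulrCA; congr (_ * (_ * _)); rewrite big_seq [RHS]big_seq.
apply: eq_bigr => j je; congr (\tr (_ ^+ _)); rewrite count_filter.
apply: eq_count => l /=; case: eqP => //= ->.
by apply/negP => /eqP ji; rewrite -ji je in ie.
Qed.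

Lemma legX_legprod n (i : 'I_n) u :
  leg n i X *m legprod R u = legprod R u *m leg n i X.
Proof.
elim: u => [|j u IHu]; first by rewrite /legprod big_nil mulmx1 mul1mx.
by rewrite legprod_cons -mulmxA -IHu !mulmxA legX_comm.
Qed.

(** A copy of X on leg [k], carried through [rho R s] and around the trace, arrives on leg [s k].
    This frees leg [k] to be traced out. *)
Lemma mxtrace_rho_shift n (s : 'S_n) (k : 'I_n) u v :
  \tr (rho R s *m legprod R (u ++ v)) =
  \tr (rho R s *m legprod R (u ++ [seq if i == k then s k else i | i <- v])).
Proof.
elim: v u => [//|i v IHv] u; rewrite -cat_rcons IHv cat_rcons /=.
case: eqP => [->|//]; rewrite !legprod_insert.
rewrite legX_legprod [in RHS]mulmxA -(leg_rho SR) -[in RHS]mulmxA [RHS]mxtrace_mulC.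
by rewrite mulmxA.
Qed.

(** Tracing out leg [y] removes the transposition of [x] and [y] and leaves one more copy of X on
    leg [x]. The case a = 0 gives the character on cycles. *)
Lemma mxtrace_rho_tperms n (x : 'I_n) l a : uniq (x :: l) ->
  d%:R ^+ (size l).+1 * \tr (rho R (\prod_(y <- l) tperm x y)%g *m legprod R (nseq a x))
  = d%:R ^+ n * \tr (X ^+ (a + size l)).
Proof.
elim: l a => [|y l IHl] a.
  move=> _; rewrite big_nil (rho1 SR) mul1mx (@mxtrace_legprod _ [:: x]) //.
    by rewrite big_seq1 count_nseq /= eqxx mul1n addn0.
  by move=> z /nseqP[-> _]; rewrite inE.
rewrite /= inE negb_or -!andbA => /and4P[xy xl yl ul].
have out : (\prod_(z <- l) tperm x z)%g y = y.
  rewrite big_seq; apply: (big_ind (fun g : 'S_n => g y = y)) => [|g h gy hy|z zl].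
  - by rewrite perm1.
  - by rewrite permM gy.
  by rewrite tpermD //; apply: contraNneq yl => <-.
have ya : y \notin nseq a x by apply/nseqP => -[yx _]; rewrite yx eqxx in xy.
rewrite exprSr -mulrA big_cons (mxtrace_tperm_rho SR xy out ya).
have -> : rcons (nseq a x) x = nseq a.+1 x by elim: (a) => //= b ->.
by rewrite IHl ?addSnnS //= xl.
Qed.

End Traces.

Lemma mxtrace_rho_eq (C : numClosedFieldType) (d : nat) (R R' : 'M[C]_(d ^ 2)) :
  is_Rmatrix R -> is_Rmatrix R' ->
  (forall m, \tr (ptr R ^+ m) = \tr (ptr R' ^+ m)) ->
  forall n (s : 'S_n), \tr (rho R s) = \tr (rho R' s).
Proof.
move=> SR SR' XX' n s.
have dn0 : d%:R != 0 :> C by rewrite pnatr_eq0 -lt0n (Rmatrix_dim SR).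
(* Each removed transposition leaves a copy of X behind, so the induction has to allow an arbitrary
   [u]. *)
suff H u : \tr (rho R s *m legprod R u) = \tr (rho R' s *m legprod R' u).
  by have := H [::]; rewrite /legprod !big_nil !mulmx1.
elim/perm_tperm_ind: s u => [|j k s jk sk IHs] u.
  rewrite (rho1 SR) (rho1 SR') !mul1mx; apply: (mulfI (expf_neq0 n dn0)).
  have eu : {subset u <= enum 'I_n} by move=> i _; rewrite mem_enum.
  rewrite -[n in _ ^+ n]card_ord cardE.
  rewrite (mxtrace_legprod R (enum_uniq _) eu) (mxtrace_legprod R' (enum_uniq _) eu).
  by congr (_ * _); apply: eq_bigr => i _.
(* All copies of X on leg [k] move to its image, which differs from [k]; then [mxtrace_tperm_rho]
   applies. *)
rewrite (mxtrace_rho_shift SR _ k [::]) (mxtrace_rho_shift SR' _ k [::]) /=.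
set v := map _ _; have kv : k \notin v.
  apply/mapP => -[i _]; rewrite permM tpermR; case: (i =P k) => [_ ksj|ik ki].
    by case/eqP: jk; apply: (@perm_inj _ s); rewrite sk.
  by case: ik.
by apply: (mulfI dn0); rewrite !mxtrace_tperm_rho.
Qed.

(** Permutations compose from left to right, so this product runs through [x :: l] in order. The
    default value [x] of [nth] closes the cycle after the last entry. *)
Lemma tperms_nth n (x : 'I_n) l i : uniq (x :: l) -> (i <= size l)%N ->
  (\prod_(y <- l) tperm x y)%g (nth x (x :: l) i) = nth x l i.
Proof.
have out z (u : seq 'I_n) : z \notin x :: u -> (\prod_(y <- u) tperm x y)%g z = z.
  elim: u => [|y u IHu]; first by rewrite big_nil perm1.
  rewrite !inE !negb_or => /and3P[zx zy zu].
  by rewrite big_cons permM tpermD 1?eq_sym // IHu // inE negb_or zx.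
elim: l i => [|y l IHl] i.
  by move=> _; rewrite leqn0 => /eqP -> /=; rewrite big_nil perm1.
rewrite /= inE negb_or -!andbA => /and4P[xy xl yl ul] il.
rewrite big_cons permM; case: i il => [_|[_|i il]] /=.
- by rewrite tpermL out // inE negb_or eq_sym xy.
- by rewrite tpermR (IHl 0%N) //= xl.
have zl : nth x l i \in l by rewrite mem_nth.
rewrite tpermD; first by rewrite (IHl i.+1) //= xl.
  by apply: contraNneq xl => ->.
by apply: contraNneq yl => ->.
Qed.

Lemma ncycle_tperms n m (s : 'S_m) : (0 < n)%N -> is_ncycle n s ->
  exists x l, [/\ uniq (x :: l), (size l).+1 = n & s = (\prod_(y <- l) tperm x y)%g].
Proof.
case: n => // n _ [x [on sx]]; pose l := traject s (s x) n.
have xl : x :: l = traject s x #|porbit s x| by rewrite on.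
have ul : uniq (x :: l) by rewrite xl uniq_traject_porbit.
exists x, l; split=> //; first by rewrite size_traject.
apply/permP=> z; have [zs|zs] := boolP (z \in porbit s x); last first.
  rewrite sx // big_seq; apply/esym.
  apply: (big_ind (fun g : 'S_m => g z = z)) => [|g h gz hz|y yl].
  - by rewrite perm1.
  - by rewrite permM gz.
  have ys : y \in porbit s x by rewrite porbit_traject -xl inE yl orbT.
  by rewrite tpermD //; apply: contraNneq zs => <-; rewrite ?porbit_id.
move: zs; rewrite porbit_traject -xl => /(nthP x)[i il <-].
have iE : nth x (x :: l) i = iter i s x.
  by rewrite xl nth_traject // on; move: il; rewrite /= size_traject.
rewrite tperms_nth // iE -iterS.
move: il; rewrite /= size_traject ltnS leq_eqVlt => /predU1P[->|il].
  by rewrite nth_default ?size_traject // -iterS -on iter_porbit.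
by rewrite (set_nth_default (s x)) ?size_traject // /l nth_traject // -iterSr iterS.
Qed.

(** * Power sums of the partial trace *)

Section PowerSums.
Variables (C : numClosedFieldType) (d r : nat) (P : 'M[C]_(d ^ 2)).
Hypothesis HP : is_YBrep_TL2 r P.

(** Both sides obey the recursion from X^2 + d X + r = 0, hence the induction over two consecutive
    exponents. The exponent m + 1 reflects the multiplicities x and y of the eigenvalues -x and
    -y. *)
Lemma mxtrace_ptr_pow (x y : C) m : x + y = d%:R -> x * y = r%:R ->
  \tr (ptr (Rmatrix_of P) ^+ m) = (-1) ^+ m * (x ^+ m.+1 + y ^+ m.+1).
Proof.
move=> xyd xyr; set X := ptr _.
suff : \tr (X ^+ m) = (-1) ^+ m * (x ^+ m.+1 + y ^+ m.+1) /\
       \tr (X ^+ m.+1) = (-1) ^+ m.+1 * (x ^+ m.+2 + y ^+ m.+2) by case.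
elim: m => [|m [IH1 IH2]].
  rewrite expr0 expr1 mxtrace1 mul1r !expr1 xyd; split=> //.
  rewrite mxtrace_ptr ?(YBrep_dim HP) // (mxtrace_Rmatrix_of HP) -xyd -xyr; ring.
split=> //; have -> : X ^+ m.+2 = - (d%:R *: X ^+ m.+1) - r%:R *: X ^+ m.
  rewrite !exprS mulrA -mulmxE (ptr_quadratic HP) -/X mulmxBl mulNmx -scalemxAl.
  by rewrite mul_scalar_mx.
rewrite raddfB raddfN /= !mxtraceZ IH1 IH2 -xyd -xyr !exprS; ring.
Qed.

Lemma YB_roots : exists x y : C, x + y = d%:R /\ x * y = r%:R.
Proof.
pose s := sqrtC (d%:R ^+ 2 - 4 * r%:R) : C.
exists ((d%:R + s) / 2), ((d%:R - s) / 2); split; first by field.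
have sE : s ^+ 2 = d%:R ^+ 2 - 4 * r%:R := sqrtCK _.
have -> : (d%:R + s) / 2 * ((d%:R - s) / 2) = (d%:R ^+ 2 - s ^+ 2) / 4 by field.
by rewrite sE; field.
Qed.

End PowerSums.

(** * Unitary equivalence from equal characters *)

Section Spectral.
Variables (C : numClosedFieldType) (N : nat).
Implicit Types (A B T : 'M[C]_N).

(** Replaces the polar decomposition: on the range of [e] the operator [T] is a multiple of an
    isometry, and [e] inherits every symmetry of [T ^t* *m T]. *)
Lemma spectral_projection T : T != 0 -> exists (c : C) (e : 'M[C]_N),
  [/\ 0 < c, e != 0, e *m e = e, e ^t* = e & (T ^t* *m T) *m e = c *: e] /\
  forall A, A *m (T ^t* *m T) = (T ^t* *m T) *m A -> A *m e = e *m A.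
Proof.
move=> T0; set H := T ^t* *m T.
have Ha : H ^t* = H by rewrite adjmxM trmxCK.
have /orthomx_spectralP HE : H \is normalmx by apply/normalmxP; rewrite Ha.
set V := spectralmx H in HE; set D := spectral_diag H in HE.
have VU : V \is unitarymx := spectral_unitarymx H.
have VV : V *m V ^t* = 1%:M by apply/unitarymxP.
have VV' : V ^t* *m V = 1%:M by exact: mulmx1C.
rewrite invmx_unitary // in HE.
have VH : V *m H *m V ^t* = diag_mx D.
  by rewrite HE !mulmxA VV mul1mx -mulmxA VV mulmx1.
have [i Di] : exists i, D 0 i != 0.
  apply/existsP; apply: contraNT T0; rewrite negb_exists => /forallP D0.
  have DE : D = 0 by apply/rowP=> i; rewrite mxE; apply/eqP; move: (D0 i); rewrite negbK.
  apply/eqP; rewrite -[T]trmxCK (@mxtrace_adj_eq0 _ _ (T ^t*)) ?trmx0 ?map_mx0 //.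
  by rewrite trmxCK -/H HE DE linear0 mulmx0 mul0mx mxtrace0.
have Dpos : 0 < D 0 i.
  rewrite lt_neqAle eq_sym Di.
  have -> : D 0 i = (diag_mx D) i i by rewrite mxE eqxx.
  rewrite -VH /H -!mulmxA mulmxA -[V in V *m T ^t*]trmxCK -adjmxM mxE.
  by apply: sumr_ge0 => k _; rewrite !mxE mulrC -normCK exprn_ge0.
(* The projection onto the whole eigenspace is taken, since a smaller one need not commute with the
   commutant. *)
pose dl := diag_mx (\row_j (D 0 j == D 0 i)%:R) : 'M[C]_N.
exists (D 0 i), (V ^t* *m dl *m V).
have conj A B : V ^t* *m A *m V *m (V ^t* *m B *m V) = V ^t* *m (A *m B) *m V.
  by rewrite -!mulmxA (mulmxA V) VV mul1mx.
have cancel A : V *m (V ^t* *m A *m V) *m V ^t* = A.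
  by rewrite !mulmxA VV mul1mx -mulmxA VV mulmx1.
split; [split=> //|].
- apply/eqP => e0; have := cancel dl; rewrite e0 mulmx0 mul0mx => /matrixP/(_ i i).
  by rewrite !mxE !eqxx => /eqP; rewrite eq_sym oner_eq0.
- rewrite conj; congr (_ *m _ *m _); rewrite mulmx_diag; congr diag_mx.
  by apply/rowP=> j; rewrite !mxE -natrM mulnb andbb.
- rewrite !adjmxM trmxCK mulmxA; congr (_ *m _ *m _).
  by apply/matrixP=> j k; rewrite !mxE rmorphMn rmorph_nat /= [j == k]eq_sym;
     case: (k =P j) => [->|_].
- rewrite HE conj scalemxAl scalemxAr; congr (_ *m _ *m _).
  rewrite mulmx_diag; apply/matrixP=> j k; rewrite !mxE.
  by case: eqP => [->|]; case: eqP; rewrite ?mulr1 ?mulr0 //= ?mulr0n ?mulr0 ?mulr1n.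
clearbody H; move=> A AH.
have BD : V *m A *m V ^t* *m diag_mx D = diag_mx D *m (V *m A *m V ^t*).
  rewrite -VH -!mulmxA (mulmxA (V ^t*)) VV' mul1mx (mulmxA A) AH.
  by rewrite (mulmxA (V ^t*) V) VV' mul1mx !mulmxA.
set B := V *m A *m V ^t* in BD.
have Bdl : B *m dl = dl *m B.
  apply/matrixP=> j k; move/matrixP: BD => /(_ j k).
  rewrite !mul_mx_diag !mul_diag_mx !mxE mulrC => /eqP.
  rewrite -subr_eq0 -mulrBl mulf_eq0 subr_eq0 => /orP[/eqP->|/eqP->].
    by rewrite mulrC.
  by rewrite mul0r mulr0.
have AE : A = V ^t* *m B *m V by rewrite /B !mulmxA VV' mul1mx -mulmxA VV' mulmx1.
by rewrite AE !conj Bdl.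
Qed.

End Spectral.

Section UnitaryEquivalence.
Variables (C : numClosedFieldType) (gT : finGroupType) (N : nat).
Variables f g : gT -> 'M[C]_N.
Hypothesis fM : forall x y, f (x * y)%g = f x *m f y.
Hypothesis f1 : f 1%g = 1%:M.
Hypothesis fA : forall x, (f x) ^t* = f (x^-1)%g.
Hypothesis gM : forall x y, g (x * y)%g = g x *m g y.
Hypothesis g1 : g 1%g = 1%:M.
Hypothesis gA : forall x, (g x) ^t* = g (x^-1)%g.
Hypothesis fg : forall x, \tr (f x) = \tr (g x).

Definition partial_isometry_intertwiner (W : 'M[C]_N) :=
  W *m W ^t* *m W = W /\ forall x, W *m f x = g x *m W.

Let pii := partial_isometry_intertwiner.

Let adj_pii W : pii W -> W ^t* *m W *m W ^t* = W ^t*.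
Proof. by case=> H _; rewrite -[in RHS]H !adjmxM trmxCK mulmxA. Qed.

Let adj_inter W : pii W -> forall x, W ^t* *m g x = f x *m W ^t*.
Proof.
case=> _ H x; have := congr1 (fun M => M ^t*) (H x^-1%g).
by rewrite /= !adjmxM fA gA invgK.
Qed.

(** The left side is the trace of the linear map M |-> A M B on matrices. *)
Lemma mxtrace_tensor (A B : 'M[C]_N) :
  \sum_i \sum_j (A *m delta_mx i j *m B) i j = \tr A * \tr B.
Proof.
rewrite mulr_suml; apply: eq_bigr => i _; rewrite mulr_sumr; apply: eq_bigr => j _.
rewrite -mulmxA mxE (bigD1 i) //= big1 ?addr0 => [|k ki].
  rewrite mxE (bigD1 j) //= big1 ?addr0 => [|k kj]; first by rewrite mxE !eqxx mul1r.
  by rewrite mxE (negPf kj) andbF mul0r.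
rewrite mxE big1 ?mulr0 // => l _.
by rewrite mxE (negPf ki) mul0r.
Qed.

(* Averaging over the group turns the vanishing of all intertwiners between the
   complements into the vanishing of the norm of their common character. *)
Lemma complement_intertwiner W : pii W -> W ^t* *m W != 1%:M ->
  exists T, [/\ T != 0, forall x, T *m f x = g x *m T,
    W ^t* *m T = 0 & T *m W ^t* = 0].
Proof.
move=> HW W1; have [WWW Wi] := HW; have WWA := adj_pii HW; have Wj := adj_inter HW.
pose p := 1%:M - W ^t* *m W; pose q := 1%:M - W *m W ^t*.
have pf x : p *m f x = f x *m p.
  by rewrite mulmxBl mulmxBr mul1mx mulmx1 -mulmxA Wi mulmxA Wj mulmxA.
have qg x : q *m g x = g x *m q.
  by rewrite mulmxBl mulmxBr mul1mx mulmx1 -mulmxA Wj mulmxA Wi mulmxA.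
have qp x : \tr (q *m g x) = \tr (p *m f x).
  rewrite !mulmxBl !mul1mx !raddfB /= fg; congr (_ - _).
  by rewrite -mulmxA Wj mulmxA mxtrace_mulC mulmxA.
have pA : p ^t* = p by rewrite adjmxB adjmx1 adjmxM trmxCK.
have pp : p *m p = p.
  by rewrite /p mulmxBr mulmx1 mulmxBl mul1mx mulmxA WWA subrr subr0.
have Wq : W ^t* *m q = 0 by rewrite mulmxBr mulmx1 mulmxA WWA subrr.
have pW : p *m W ^t* = 0 by rewrite mulmxBl mul1mx WWA subrr.
(* The group average makes [T A] an intertwiner; [p] and [q] project onto the complements of the
   initial and final space of [W]. *)
pose T A := \sum_x q *m g x *m A *m (f x^-1%g *m p).
have WT A : W ^t* *m T A = 0.
  by rewrite mulmx_sumr big1 // => x _; rewrite !mulmxA Wq !mul0mx.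
have TW A : T A *m W ^t* = 0.
  by rewrite mulmx_suml big1 // => x _; rewrite -!mulmxA pW !mulmx0.
have Ti A y : T A *m f y = g y *m T A.
  rewrite mulmx_suml mulmx_sumr [RHS](reindex_inj (mulgI y^-1%g)) /=.
  apply: eq_bigr => x _; rewrite gM invMg invgK fM -!mulmxA pf.
  rewrite (mulmxA (g y)) -qg -!mulmxA; congr (_ *m _).
  by rewrite (mulmxA (g y)) -gM mulgV g1 mul1mx.
have [/existsP[ij nz]|] := boolP [exists ij, T (delta_mx ij.1 ij.2) != 0].
  by exists (T (delta_mx ij.1 ij.2)).
rewrite negb_exists => /forallP T0.
(* The trace of the map A |-> T A is computed in two ways: it is 0, and it is the sum of the squared
   moduli of the character of the complement. *)
have {T0} S0 : \sum_x `|\tr (p *m f x)| ^+ 2 = 0.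
  transitivity (\sum_i \sum_j (T (delta_mx i j)) i j); last first.
    apply: big1 => i _; apply: big1 => j _.
    by move: (T0 (i, j)); rewrite negbK /= => /eqP ->; rewrite mxE.
  under [RHS]eq_bigr => i _ do under eq_bigr => j _ do rewrite summxE.
  under [RHS]eq_bigr => i _ do rewrite exchange_big /=.
  rewrite exchange_big /=; apply: eq_bigr => x _.
  rewrite mxtrace_tensor qp normCK; congr (_ * _).
  by rewrite -trace_map_mx -[LHS]mxtrace_tr map_trmx adjmxM pA fA.
have : p = 0.
  apply: mxtrace_adj_eq0; rewrite pA pp; apply/eqP.
  (* The summand at the identity of the group is the square of Tr p. *)
  move/eqP: S0; rewrite psumr_eq0 => [|x _]; last exact: exprn_ge0.
  by move=> /allP/(_ 1%g (mem_index_enum _)); rewrite f1 mulmx1 /= expf_eq0 normr_eq0.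
by move/eqP; rewrite subr_eq0 eq_sym (negPf W1).
Qed.

(** A suitable multiple of T e is a partial isometry whose initial and final spaces are orthogonal
    to those of [W]. Adding it to [W] enlarges the initial projection by [e]. *)
Lemma extend_pii W : pii W -> W ^t* *m W != 1%:M ->
  exists W', pii W' /\ (\rank (W ^t* *m W) < \rank (W' ^t* *m W'))%N.
Proof.
move=> HW W1; have [T [T0 Ti WT TW]] := complement_intertwiner HW W1.
have [WWW Wi] := HW; have WWA := adj_pii HW.
have [c [e [[c0 e0 ee ea Te] ec]]] := spectral_projection T0.
have Tj x : T ^t* *m g x = f x *m T ^t*.
  by have := congr1 (fun M => M ^t*) (Ti x^-1%g); rewrite /= !adjmxM fA gA invgK.
have ef x : f x *m e = e *m f x.
  by apply: ec; rewrite -mulmxA Ti !mulmxA Tj.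
have eT : e *m (T ^t* *m T) = c *: e.
  have := congr1 (fun M => M ^t*) Te.
  by rewrite /= !adjmxM trmxCK ea => ->; rewrite adjmxZ conj_Creal ?gtr0_real // ea.
have eW : e *m W ^t* = 0.
  apply: (scalerI (lt0r_neq0 c0)).
  by rewrite scaler0 scalemxAl -eT -!mulmxA TW !mulmx0.
have We : W *m e = 0.
  by rewrite -[W]trmxCK -ea -adjmxM eW trmx0 map_mx0.
pose s := (sqrtC c)^-1; pose W2 := s *: (T *m e).
have ss : s * s * c = 1.
  by rewrite -[X in _ * X](sqrtCK c) /s; field; rewrite sqrtC_eq0 lt0r_neq0.
have sR : s^* = s by rewrite conj_Creal // ger0_real // invr_ge0 sqrtC_ge0 ltW.
have W2A : W2 ^t* = s *: (e *m T ^t*).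
  by rewrite adjmxZ sR adjmxM ea.
have W2W2 : W2 ^t* *m W2 = e.
  rewrite W2A -scalemxAl -scalemxAr scalerA mulmxA -(mulmxA e) eT -scalemxAl scalerA.
  by rewrite ss scale1r ee.
have WW2 : W ^t* *m W2 = 0 by rewrite -scalemxAr mulmxA WT mul0mx scaler0.
have W2W : W2 *m W ^t* = 0 by rewrite -scalemxAl -mulmxA eW mulmx0 scaler0.
have W2e : W2 *m e = W2 by rewrite -scalemxAl -mulmxA ee.
have WW2A : W *m W2 ^t* = 0.
  by rewrite -[W]trmxCK -adjmxM W2W trmx0 map_mx0.
have W2WA : W2 ^t* *m W = 0.
  by rewrite -[W in _ *m W]trmxCK -adjmxM WW2 trmx0 map_mx0.
have SS : (W + W2) ^t* *m (W + W2) = W ^t* *m W + e.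
  by rewrite adjmxD mulmxDl !mulmxDr WW2 W2WA W2W2 addr0 add0r.
exists (W + W2); split; last first.
  rewrite SS -(ltr_nat C) -!mxtrace_idem.
  - by rewrite mxtraceD ltrDl (mxtrace_idem ee) ltr0n lt0n mxrank_eq0.
  - have H1 : W ^t* *m W *m e = 0 by rewrite -mulmxA We mulmx0.
    have H2 : e *m (W ^t* *m W) = 0 by rewrite mulmxA eW mul0mx.
    by rewrite mulmxDl !mulmxDr ee H1 H2 mulmxA WWA addr0 add0r.
  - by rewrite mulmxA WWA.
split.
  by rewrite -mulmxA SS mulmxDl !mulmxDr !mulmxA WWW We W2W mul0mx W2e addr0 add0r.
move=> x; rewrite mulmxDl mulmxDr Wi; congr (_ + _).
by rewrite -scalemxAl -mulmxA -ef mulmxA Ti -mulmxA -scalemxAr.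
Qed.

(** Starting from 0, a partial isometry is extended until its initial projection is the identity;
    the rank is bounded by [N]. *)
Lemma unitary_equivalence : exists U : 'M[C]_N,
  [/\ U *m U ^t* = 1%:M, U ^t* *m U = 1%:M & forall x, U *m f x = g x *m U].
Proof.
suff [U [[_ Ui] UU]] : exists U, pii U /\ U ^t* *m U = 1%:M.
  by exists U; split=> //; apply: mulmx1C.
have : pii 0 by split=> [|x]; rewrite ?mulmx0 ?mul0mx.
move: {1}0 => W; have [m] := ubnP (N - \rank (W ^t* *m W)).
elim: m W => // m IHm W; rewrite ltnS => Wm HW.
have [WW|/(extend_pii HW)[W' [HW' WW']]] := eqVneq (W ^t* *m W) 1%:M; first by exists W.
apply: IHm HW'; apply: leq_trans Wm; apply: ltn_sub2l => //.
exact: leq_trans WW' (rank_leq_row _).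
Qed.

End UnitaryEquivalence.

(** * Existence of representations *)

Section Model.
Variables (C : numClosedFieldType) (d x : nat).
Hypothesis xd : (x <= d)%N.

Implicit Types a b c : 'I_d.

Let m a b : C := ((a < x)%N != (b < x)%N)%:R.

(* On vectors |ab> the projection is (|ab> + |ba>) / 2 if exactly one of a, b is
   below x, and 0 otherwise. *)
Definition mixed_sym : 'M[C]_(d ^ 2) :=
  \matrix_(i < d * d, j < d * d) (let: (a, b) := mxtens_unindex i in
     m a b / 2 * ((j == i)%:R + (j == mxtens_index (b, a))%:R)).

Let mC a b : m a b = m b a. Proof. by rewrite /m eq_sym. Qed.

Let mm a b : m a b * m a b = m a b.
Proof. by rewrite /m -natrM mulnb andbb. Qed.

Lemma mixed_symE a b j : (mixed_sym : 'M[C]_(d * d)) (mxtens_index (a, b)) j =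
  m a b / 2 * ((j == mxtens_index (a, b))%:R + (j == mxtens_index (b, a))%:R).
Proof. by rewrite mxE mxtens_indexK. Qed.

Lemma sum_mixed_sym a b (F : 'I_(d * d) -> C) :
  \sum_j (mixed_sym : 'M[C]_(d * d)) (mxtens_index (a, b)) j * F j =
  m a b / 2 * (F (mxtens_index (a, b)) + F (mxtens_index (b, a))).
Proof.
under eq_bigr => j _ do rewrite mixed_symE -mulrA mulrDl.
rewrite -mulr_sumr big_split /=; congr (_ * (_ + _)).
  by rewrite (bigD1 (mxtens_index (a, b))) //= eqxx mul1r big1 ?addr0 // => j /negPf->;
    rewrite mul0r.
by rewrite (bigD1 (mxtens_index (b, a))) //= eqxx mul1r big1 ?addr0 // => j /negPf->;
    rewrite mul0r.
Qed.

Lemma mixed_sym_idem : mixed_sym *m mixed_sym = mixed_sym.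
Proof.
apply/matrixP=> i j; case: (mxtens_indexP i) => a b.
rewrite mxE sum_mixed_sym !mixed_symE (mC b a).
by rewrite -[in RHS](mm a b); field.
Qed.

Lemma mixed_sym_adj : mixed_sym ^t* = mixed_sym.
Proof.
apply/matrixP=> i j; case: (mxtens_indexP i) => a b; case: (mxtens_indexP j) => a' b'.
rewrite 2!mxE !mixed_symE !(can_eq (@mxtens_indexK d d)) !xpair_eqE.
rewrite rmorphM rmorphD !rmorph_nat rmorphM fmorphV !rmorph_nat.
rewrite (eq_sym a' a) (eq_sym b' b) (eq_sym a' b) (eq_sym b' a) [(b == a') && _]andbC.
have [/andP[/eqP<- /eqP<-]//|_] := boolP ((a == a') && (b == b')).
have [/andP[/eqP<- /eqP<-]|_] := boolP ((a == b') && (b == a')); first by rewrite mC.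
by rewrite !addr0 !mulr0.
Qed.

Lemma mxtrace_mixed_sym : \tr mixed_sym = (x * (d - x))%:R.
Proof.
have -> : \tr mixed_sym = \sum_a \sum_b m a b / 2.
  rewrite /mxtrace sum_mxtens_index; apply: eq_bigr => a _; apply: eq_bigr => b _.
  rewrite mixed_symE eqxx (can_eq (@mxtens_indexK d d)).
  (* The second delta meets the diagonal only for a = b, where [m a b] vanishes. *)
  rewrite xpair_eqE /=; case: (a =P b) => [->|_]; last by rewrite addr0 mulr1.
  by rewrite /m eqxx mul0r mul0r.
have cx : \sum_(a < d) ((a < x)%N%:R : C) = x%:R.
  transitivity (\sum_(a < d) (if (a < x)%N then 1 else 0 : C)).
    by apply: eq_bigr => a _; case: ltnP.
  by rewrite -big_mkcond (big_ord_narrow xd) sumr_const card_ord.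
have cx' : \sum_(a < d) (1 - (a < x)%N%:R : C) = (d - x)%:R.
  by rewrite sumrB cx sumr_const card_ord natrB.
have mE a b : m a b / 2 = ((a < x)%N%:R / 2 * (1 - (b < x)%N%:R)
    + (1 - (a < x)%N%:R) / 2 * (b < x)%N%:R).
  by rewrite /m; case: (a < x)%N; case: (b < x)%N; rewrite /=; ring.
under eq_bigr => a _ do under eq_bigr => b _ do rewrite mE.
under eq_bigr => a _ do rewrite big_split /= -!mulr_sumr cx cx'.
by rewrite big_split /= -!mulr_suml cx cx' natrM; field.
Qed.

Let w a b c : 'I_(d ^ 3) := mxtens_index (a, mxtens_index (b, c)).

Lemma tens_at0_mixed (Z : 'M[C]_(d ^ 3)) a b c j :
  (tens_at 3 0 mixed_sym *m Z) (w a b c) j = m a b / 2 * (Z (w a b c) j + Z (w b a c) j).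
Proof.
have e : (d ^ 3 = d ^ 2 * d)%N := mulnA d d d.
have -> : tens_at 3 0 mixed_sym = fitmx (d ^ 3) (mixed_sym *t (1%:M : 'M[C]_d)).
  by rewrite tens_at_fit // -fitmx_tensA fitmx_tens1l.
have {1}-> : Z = fitmx (d ^ 3) (fitmx (d ^ 2 * d) Z).
  by apply/matrixP=> i k; rewrite (fitmxE e) (fitmxE (esym e)) !cast_ordK.
rewrite -fitmxM (fitmxE e).
have E a' b' c' : cast_ord e (w a' b' c') = mxtens_index (mxtens_index (a', b'), c').
  by apply: val_inj => /=; lia.
rewrite !E tensmx1_mulE sum_mixed_sym !(fitmxE (esym e)) -!E.
by rewrite !cast_ordK.
Qed.

Lemma tens_at1_mixed (Z : 'M[C]_(d ^ 3)) a b c j :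
  (tens_at 3 1 mixed_sym *m Z) (w a b c) j = m b c / 2 * (Z (w a b c) j + Z (w a c b) j).
Proof.
have -> : tens_at 3 1 mixed_sym = (1%:M : 'M[C]_d) *t mixed_sym.
  by rewrite tens_at_fit // [LHS]fitmx_tens1r -[RHS]fitmx_id.
by rewrite tens1mx_mulE sum_mixed_sym.
Qed.

Lemma mixed_sym_TL : TL_relations mixed_sym.
Proof.
split; apply/matrixP=> i j; case: (mxtens_indexP i) => a bc;
  case: (mxtens_indexP bc) => b c; rewrite -/(w a b c) [RHS]mxE.
(* The factor [1%:M] gives the rightmost operator something to act on. Eight cases remain, according
   to which of a, b, c are below x. *)
- rewrite -[tens_at 3 0 mixed_sym]mulmx1 -!mulmxA mul1mx !(tens_at0_mixed, tens_at1_mixed).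
  by rewrite /m; case: (a < x)%N; case: (b < x)%N; case: (c < x)%N => /=; field.
- rewrite -[tens_at 3 1 mixed_sym]mulmx1 -!mulmxA mul1mx !(tens_at0_mixed, tens_at1_mixed).
  by rewrite /m; case: (a < x)%N; case: (b < x)%N; case: (c < x)%N => /=; field.
Qed.

Lemma mixed_sym_YBrep : (0 < d)%N -> is_YBrep_TL2 (x * (d - x)) mixed_sym.
Proof.
move=> d0; split; [exact: d0 | exact: mixed_sym_idem | exact: mixed_sym_adj | |].
  apply/eqP; rewrite -(eqr_nat C) -mxtrace_mixed_sym eq_sym; apply/eqP.
  exact: mxtrace_idem mixed_sym_idem.
exact: mixed_sym_TL.
Qed.

End Model.

(** * Uniqueness of Thoma parameters *)

Section Thoma.
Local Open Scope classical_set_scope.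
Local Open Scope ring_scope.
Variables (K : realType) (p q : K).
Hypotheses (q0 : 0 <= q) (qp : q <= p) (pq1 : p + q = 1).
Implicit Types u : nat -> K.

Let p0 : 0 < p. Proof. by move: q0 qp pq1; lra. Qed.

Lemma series_pow_cvg u n : (0 < n)%N -> (forall i, 0 <= u i) ->
  (forall N, series u N <= 1) -> cvgn (series (fun i => u i ^+ n)).
Proof.
move=> n0 u0 u1; apply: nondecreasing_is_cvgn.
  by apply/nondecreasing_seqP => N; rewrite seriesSr lerDl exprn_ge0.
exists 1 => _ [N _ <-]; apply: le_trans (u1 N).
apply: ler_sum => i _; case: n n0 => // n _; rewrite exprS ler_piMr // exprn_ile1 //.
apply: le_trans (u1 i.+1); rewrite seriesSr lerDr; exact: sumr_ge0.
Qed.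

Section Uniqueness.
Variables alpha beta : nat -> K.
Hypotheses (a0 : forall i, 0 <= alpha i) (b0 : forall i, 0 <= beta i).
Hypothesis ab1 : forall N, series alpha N + series beta N <= 1.
Hypothesis power_sums : forall n, (2 <= n)%N ->
  limn (series (fun i => alpha i ^+ n))
  + (-1) ^+ n.+1 * limn (series (fun i => beta i ^+ n))
  = (-1) ^+ n.+1 * (p ^+ n + q ^+ n).

Let sa0 N : 0 <= series alpha N. Proof. exact: sumr_ge0. Qed.
Let sb0 N : 0 <= series beta N. Proof. exact: sumr_ge0. Qed.
Let sa1 N : series alpha N <= 1. Proof. by apply: le_trans (ab1 N); rewrite lerDl. Qed.
Let sb1 N : series beta N <= 1. Proof. by apply: le_trans (ab1 N); rewrite lerDr. Qed.

(** The moment of order n - 1 of the measure with mass beta_i at beta_i and alpha_i at -alpha_i,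
    truncated to i < N. *)
Let E n N := series (fun i => beta i ^+ n) N
  + (-1) ^+ n.+1 * series (fun i => alpha i ^+ n) N.

Let E_cvg n : (2 <= n)%N -> E n N @[N --> \oo] --> p ^+ n + q ^+ n.
Proof.
move=> n2; have n0 : (0 < n)%N by exact: ltnW.
have -> : p ^+ n + q ^+ n = limn (series (fun i => beta i ^+ n))
    + (-1) ^+ n.+1 * limn (series (fun i => alpha i ^+ n)).
  have := congr1 ( *%R ((-1) ^+ n.+1)) (power_sums n2).
  by rewrite mulrDr !mulrA -expr2 sqrr_sign !mul1r addrC => ->.
apply: cvgD; first exact: series_pow_cvg.
by apply: cvgMl_tmp; exact: series_pow_cvg.
Qed.

(* Integrating t^2 (t - p)^2 (t - q)^2 against the measure with mass beta_i at beta_i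
   and alpha_i at -alpha_i, whose moments are those of p delta_p + q delta_q. *)
Let F i := beta i ^+ 3 * ((beta i - p) * (beta i - q)) ^+ 2
  + alpha i ^+ 3 * ((alpha i + p) * (alpha i + q)) ^+ 2.

Let F0 i : F i = 0.
Proof.
have Fge0 j : 0 <= F j by apply: addr_ge0; apply: mulr_ge0; rewrite ?sqr_ge0 ?exprn_ge0.
(* The coefficients are those of the square of t^2 - (p + q) t + p q. The factor t^2 in the
   integrand shifts the indices to 3 up to 7, where the power sums are known. *)
have FE N : series F N = E 7 N + - (2 * (p + q)) * E 6 N
    + ((p + q) ^+ 2 + 2 * (p * q)) * E 5 N + - (2 * (p + q) * (p * q)) * E 4 N
    + (p * q) ^+ 2 * E 3 N.
  elim: N => [|N IHN].
    by rewrite /E /series /= !big_geq // !mulr0 !addr0 !mulr0 !addr0.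
  by rewrite seriesSr IHN /E !seriesSr /F; ring.
have Fcvg : series F N @[N --> \oo] --> (0 : K).
  have -> : series F = fun N => E 7 N + - (2 * (p + q)) * E 6 N
    + ((p + q) ^+ 2 + 2 * (p * q)) * E 5 N + - (2 * (p + q) * (p * q)) * E 4 N
    + (p * q) ^+ 2 * E 3 N by apply/funext => N; exact: FE.
  have -> : 0 = (p ^+ 7 + q ^+ 7) + - (2 * (p + q)) * (p ^+ 6 + q ^+ 6)
    + ((p + q) ^+ 2 + 2 * (p * q)) * (p ^+ 5 + q ^+ 5)
    + - (2 * (p + q) * (p * q)) * (p ^+ 4 + q ^+ 4)
    + (p * q) ^+ 2 * (p ^+ 3 + q ^+ 3) by ring.
  do 4!(apply: cvgD; last by apply: cvgMl_tmp; exact: E_cvg).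
  exact: E_cvg.
(* Partial sums of nonnegative terms that increase to 0 leave every term equal to 0. *)
have Fnd : nondecreasing_seq (series F).
  by apply/nondecreasing_seqP => N; rewrite seriesSr lerDl.
have := nondecreasing_cvgn_le Fnd (cvgP _ Fcvg) i.+1.
rewrite (cvg_lim _ Fcvg) // seriesSr => Fi.
apply/eqP; rewrite eq_le Fge0 andbT; apply: le_trans Fi; rewrite lerDr.
exact: sumr_ge0.
Qed.

Lemma alpha_eq0 i : alpha i = 0.
Proof.
apply/eqP; have ai : 0 <= alpha i ^+ 3 * ((alpha i + p) * (alpha i + q)) ^+ 2.
  by rewrite mulr_ge0 ?sqr_ge0 ?exprn_ge0.
have bi : 0 <= beta i ^+ 3 * ((beta i - p) * (beta i - q)) ^+ 2.
  by rewrite mulr_ge0 ?sqr_ge0 ?exprn_ge0.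
have := F0 i => /eqP; rewrite paddr_eq0 // => /andP[_].
rewrite mulf_eq0 !expf_eq0 /= mulf_eq0 => /or3P[//|/eqP|/eqP];
  have := a0 i; move: q0 p0; lra.
Qed.

Lemma beta_values i : [|| beta i == 0, beta i == p | beta i == q].
Proof.
have ai : 0 <= alpha i ^+ 3 * ((alpha i + p) * (alpha i + q)) ^+ 2.
  by rewrite mulr_ge0 ?sqr_ge0 ?exprn_ge0.
have bi : 0 <= beta i ^+ 3 * ((beta i - p) * (beta i - q)) ^+ 2.
  by rewrite mulr_ge0 ?sqr_ge0 ?exprn_ge0.
have := F0 i => /eqP; rewrite paddr_eq0 // => /andP[+ _].
by rewrite mulf_eq0 !expf_eq0 /= mulf_eq0 !subr_eq0.
Qed.

Hypothesis bnd : nonincreasing_seq beta.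

Let b2_cvg : series (fun i => beta i ^+ 2) N @[N --> \oo] --> p ^+ 2 + q ^+ 2.
Proof.
have -> : series (fun i => beta i ^+ 2) = E 2; last exact: E_cvg.
apply/funext => N; rewrite /E [X in _ * X](_ : _ = 0) ?mulr0 ?addr0 //.
by rewrite /series /= big1 // => i _; rewrite alpha_eq0 expr0n.
Qed.

Let b2_le c : (forall N, series (fun i => beta i ^+ 2) N <= c) -> p ^+ 2 + q ^+ 2 <= c.
Proof.
move=> H; rewrite -(cvg_lim _ b2_cvg) //; apply: limr_le; first exact: cvgP b2_cvg.
exact: nearW.
Qed.

(** The sum of the beta_i^2 is at most beta_0 times that of the beta_i, so p^2 + q^2 <= beta_0. A
    value other than p would be at most q and below p, which contradicts p + q = 1. *)
Lemma beta0E : beta 0%N = p.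
Proof.
apply/eqP; apply/negPn/negP => bp.
have bq : beta 0%N <= q.
  by have /or3P[/eqP->//|b|/eqP->//] := beta_values 0%N; rewrite b in bp.
have : p ^+ 2 + q ^+ 2 <= beta 0%N.
  apply: b2_le => N; apply: (@le_trans _ _ (beta 0%N * series beta N)); last first.
    by rewrite ler_piMr.
  rewrite /series /= mulr_sumr; apply: ler_sum => i _; rewrite expr2.
  by apply: ler_wpM2r => //; exact: bnd.
have : beta 0%N < p.
  by rewrite lt_neqAle bp (le_trans bq qp).
move: bq q0 qp pq1; nra.
Qed.

(** The bound on the sum leaves at most q. If beta_1 were 0, monotonicity would reduce the sum of
    squares to p^2 and force q = 0. *)
Lemma beta1E : beta 1%N = q.
Proof.
have s2 : beta 0%N + beta 1%N <= 1.
  by apply: le_trans (sb1 2); rewrite /series /= big_nat_recr //= big_nat1.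
have b1q : beta 1%N <= q by rewrite beta0E in s2; move: s2 pq1; lra.
have /or3P[/eqP b1|/eqP b1|/eqP//] := beta_values 1%N; last by move: b1 b1q qp; lra.
suff : p ^+ 2 + q ^+ 2 <= p ^+ 2 by rewrite b1; move: q0; nra.
apply: b2_le => -[|N]; first by rewrite /series /= big_geq // sqr_ge0.
rewrite /series /= big_nat_recl //= beta0E big1 ?addr0 // => i _.
have := bnd (ltn0Sn i); rewrite b1 => bi; have := b0 i.+1 => bi'.
by have -> : beta i.+1 = 0 by [apply/eqP; rewrite eq_le bi bi']; rewrite expr0n.
Qed.

Lemma beta_eq0 i : (2 <= i)%N -> beta i = 0.
Proof.
move=> i2; apply/eqP; rewrite eq_le b0 andbT.
have := sb1 i.+1; rewrite seriesSr; have -> : i = i.-2.+2 by lia.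
rewrite {1}/series /= !big_nat_recl //= beta0E beta1E.
have : 0 <= \sum_(0 <= j < i.-2) beta j.+2 by exact: sumr_ge0.
move: pq1; lra.
Qed.

End Uniqueness.

Definition two_params i : K := if i is 0 then p else if i is 1 then q else 0.

Lemma series_two_params n N : (0 < n)%N -> (2 <= N)%N ->
  series (fun i => two_params i ^+ n) N = p ^+ n + q ^+ n.
Proof.
case: n => // n _; case: N => [|[|N]] // _.
rewrite /series /= !big_nat_recl //= big1 ?addr0 // => i _.
by rewrite expr0n.
Qed.

End Thoma.

(** * Thoma parameters of Temperley-Lieb R-matrices *)

Section Thoma_TL.
Variables (K : realType) (d r : nat) (S : 'M[K[i]]_(d ^ 2)).
Hypotheses (SR : is_Rmatrix S) (STL : TL_type S) (Sr : has_rank S r).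

Let d0 : (0 < d)%N := Rmatrix_dim SR.
Let P := proj_plus S.

Lemma proj_plus_YBrep : is_YBrep_TL2 r P.
Proof.
have SS := Rmatrix_invol SR.
have PP : P *m P = P.
  rewrite /P /proj_plus -scalemxAl -scalemxAr mulmxDl !mulmxDr SS mulmx1 !mul1mx.
  by apply/matrixP=> i j; rewrite !mxE; field.
split=> //.
- by rewrite /P /proj_plus adjmxZ adjmxD adjmx1 (Rmatrix_herm SR) fmorphV rmorph_nat.
- by apply/eqP; rewrite -(eqr_nat K[i]) -(mxtrace_idem PP) [\tr P]Sr.
Qed.

Lemma Rmatrix_of_proj_plus : Rmatrix_of P = S.
Proof.
by rewrite /Rmatrix_of /P /proj_plus scalerA mulfV ?pnatr_eq0 // scale1r addrK.
Qed.

Let disc : K := 1 - 4 * r%:R / d%:R ^+ 2.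
Let p : K := 2^-1 * (1 + Num.sqrt disc).
Let q : K := 2^-1 * (1 - Num.sqrt disc).

Let dn0 : d%:R != 0 :> K. Proof. by rewrite pnatr_eq0 -lt0n. Qed.

(** Integrality makes [disc] the square of k / d. Hence [Num.sqrt], which is 0 on negative numbers,
    is a true square root here. *)
Lemma disc_ge0 : 0 <= disc.
Proof.
have [k kE] := TL_disc_square proj_plus_YBrep.
have E : d%:R ^+ 2 - 4 * r%:R = k%:R ^+ 2 :> K.
  by have := congr1 (fun z : int => z%:~R : K) kE; rewrite intrB intrM !rmorphXn.
have -> : disc = (k%:R / d%:R) ^+ 2.
  by rewrite /disc expr_div_n -E; field.
exact: sqr_ge0.
Qed.

Let pq1 : p + q = 1. Proof. by rewrite /p /q; field. Qed.

Let pq : p * q = r%:R / d%:R ^+ 2.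
Proof.
have -> : p * q = 4^-1 * (1 - Num.sqrt disc ^+ 2) by rewrite /p /q; field.
by rewrite sqr_sqrtr ?disc_ge0 // /disc; field.
Qed.

Let qp : q <= p.
Proof. by have := sqrtr_ge0 disc; rewrite /p /q; lra. Qed.

Let q0 : 0 <= q.
Proof.
have : 0 <= p * q by rewrite pq divr_ge0 ?ler0n ?exprn_ge0.
by rewrite pmulr_rge0 //; move: qp pq1; lra.
Qed.

Lemma YB_char_ncycle n m (s : 'S_m) : (2 <= n)%N -> is_ncycle n s ->
  YB_char S s = ((-1) ^+ n.+1 * (p ^+ n + q ^+ n))%:C%C.
Proof.
move=> n2 /ncycle_tperms[|x [l [ul sl sE]]]; first exact: ltnW.
have dC : d%:R != 0 :> K[i] by rewrite pnatr_eq0 -lt0n.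
(* The roots of t^2 - d t + r are d p and d q. *)
have xy : d%:R * p%:C%C + d%:R * q%:C%C = d%:R.
  by rewrite -mulrDr -rmorphD pq1 mulr1.
have xyr : d%:R * p%:C%C * (d%:R * q%:C%C) = r%:R.
  rewrite mulrACA -[p%:C%C * q%:C%C]rmorphM pq rmorphM fmorphV rmorphXn !rmorph_nat; field.
  exact: dC.
have trX := mxtrace_ptr_pow proj_plus_YBrep (size l) xy xyr.
rewrite Rmatrix_of_proj_plus sl !exprMn -mulrDr in trX.
have := mxtrace_rho_tperms SR 0 ul.
rewrite -sE sl /legprod big_nil mulmx1 add0n trX => E; rewrite /YB_char.
have dnC j : d%:R ^+ j != 0 :> K[i] by rewrite expf_neq0.
rewrite rmorphM rmorphD !rmorphXn rmorphN1.
apply: (mulfI (dnC n)); rewrite mulrCA E mulKf // mulrCA -sl.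
by congr (_ * (_ * _)); rewrite !exprS !mulN1r opprK.
Qed.

Lemma series_cst0 (T : zmodType) : series (fun _ : nat => 0 : T) = fun _ => 0.
Proof. by apply/funext => N; rewrite /series /= big1. Qed.

Lemma TL_Thoma_exists : exists alpha beta, is_Thoma_params (YB_char S) alpha beta.
Proof.
have p0 : 0 <= p by apply: le_trans qp.
have pge i : 0 <= two_params p q i by case: i => [|[|i]].
exists (fun=> 0), (two_params p q); split=> //.
- by apply/nonincreasing_seqP => -[|[|i]] /=.
- rewrite eseries0 // add0e (@lim_near_cst _ (@ereal_hausdorff K) _ _ _ 1%E) //.
  exists 2 => // N /= N2; rewrite sumEFin.
  have := series_two_params p q (ltnSn 0) N2; rewrite !expr1 pq1 => <-.
  by congr EFin; apply: eq_bigr => i _; rewrite expr1.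
move=> n m s n2 sn; rewrite (YB_char_ncycle n2 sn); congr (_%:C%C).
have n0 : (0 < n)%N by exact: ltnW.
have -> : limn (series (fun _ : nat => 0 ^+ n : K)) = 0.
  by under eq_fun do rewrite expr0n eqn0Ngt n0; rewrite series_cst0 lim_cst.
rewrite add0r; congr (_ * _); apply/esym/lim_near_cst => //.
exists 2 => // N /= N2; exact: series_two_params.
Qed.

(** The cyclic successor is an n-cycle. Its existence turns the condition on cycles into equations
    for the power sums. *)
Lemma ncycle_exists n : (0 < n)%N -> exists s : 'S_n, is_ncycle n s.
Proof.
case: n => // n _; pose s := perm (can_inj (@ordSK n.+1)); exists s, ord0.
have sT i : i \in porbit s ord0.
  have -> : i = (s ^+ i)%g ord0; last exact: mem_porbit.
  apply: val_inj; rewrite permX /=; have : (i <= n)%N by exact: leq_ord.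
  elim: (nat_of_ord i) => //= k IHk kn.
  by rewrite permE /= -IHk ?modn_small // ltnW.
split=> [|y]; last by rewrite sT.
by rewrite -[RHS]card_ord; apply: eq_card => i; rewrite sT.
Qed.

Lemma TL_Thoma_unique alpha beta : is_Thoma_params (YB_char S) alpha beta ->
  [/\ forall i, alpha i = 0, beta 0%N = p, beta 1%N = q
    & forall i, (2 <= i)%N -> beta i = 0].
Proof.
case=> and bnd a0 b0 sum1 cyc.
have ab1 N : series alpha N + series beta N <= 1.
  rewrite -lee_fin EFinD; apply: le_trans sum1; apply: leeD.
    by rewrite /series /= -sumEFin; apply: nneseries_lim_ge => i _ _; rewrite lee_fin.
  by rewrite /series /= -sumEFin; apply: nneseries_lim_ge => i _ _; rewrite lee_fin.
have pow n : (2 <= n)%N -> limn (series (fun i => alpha i ^+ n))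
    + (-1) ^+ n.+1 * limn (series (fun i => beta i ^+ n))
    = (-1) ^+ n.+1 * (p ^+ n + q ^+ n).
  move=> n2; have [s sn] := ncycle_exists (ltnW n2).
  by apply: complexI; rewrite -(cyc n n s) // (YB_char_ncycle n2 sn).
split.
- exact: (alpha_eq0 q0 qp pq1 a0 b0 ab1 pow).
- exact: (beta0E q0 qp pq1 a0 b0 ab1 pow bnd).
- exact: (beta1E q0 qp pq1 a0 b0 ab1 pow bnd).
- exact: (beta_eq0 q0 qp pq1 a0 b0 ab1 pow bnd).
Qed.

End Thoma_TL.

(** * Classification by dimension and rank *)

Lemma nat_square_split d r k : d%:Z ^+ 2 - 4 * r%:Z = k%:Z ^+ 2 ->
  exists2 x, (x <= d)%N & r = (x * (d - x))%N.
Proof.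
move=> E; have {}E : (d * d = 4 * r + k * k)%N by nia.
have kd : (k <= d)%N by nia.
(* [d] and [k] have the same parity, and z = (d - k) / 2. The witness k + z is the larger root of
   t^2 - d t + r. *)
have [z dE] : exists z, d = (k + 2 * z)%N.
  exists (d - k)./2; have := odd_double_half (d - k).
  have : odd (d * d) = odd (4 * r + k * k) by rewrite E.
  rewrite oddD !oddM !andbb /= => dk; rewrite oddB // dk addbb; lia.
by exists (k + z)%N; [lia | nia].
Qed.

Lemma YB_equivP (C : numClosedFieldType) (d r d' r' : nat)
    (P : 'M[C]_(d ^ 2)) (P' : 'M[C]_(d' ^ 2)) :
  is_YBrep_TL2 r P -> is_YBrep_TL2 r' P' ->
  YB_equiv (Rmatrix_of P) (Rmatrix_of P') <-> d = d' /\ r = r'.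
Proof.
move=> HP HP'; have SR := Rmatrix_of_is_Rmatrix HP; have SR' := Rmatrix_of_is_Rmatrix HP'.
split=> [eqv|[dd rr]].
  (* Level n = 1 compares the dimensions, and level n = 2 the traces 2 r - d^2 of the R-matrices. *)
  have dd : d = d'.
    have [U [UU UU' _]] := eqv 1 isT; apply/esym/eqP; rewrite -(eqr_nat C); apply/eqP.
    have : \tr (U *m U ^t*) = \tr (U ^t* *m U) by rewrite mxtrace_mulC.
    by rewrite UU UU' !mxtrace1.
  subst d'; split=> //; have [U [UU UU' Ui]] := eqv 2 isT.
  have : \tr (rho (Rmatrix_of P') (adj_tperm (ord0 : 'I_2.-1))) =
         \tr (rho (Rmatrix_of P) (adj_tperm (ord0 : 'I_2.-1))).
    rewrite -[rho (Rmatrix_of P') _]mulmx1 -UU mulmxA -Ui mxtrace_mulC mulmxA UU'.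
    by rewrite mul1mx.
  rewrite !rho_adj_tperm // !mxtrace_tens_at //.
  rewrite (mxtrace_Rmatrix_of HP) (mxtrace_Rmatrix_of HP').
  rewrite !mul1r => /addIr /mulfI H; apply/esym/eqP; rewrite -(eqr_nat C); apply/eqP/H.
  by rewrite pnatr_eq0.
subst d' r'; move=> n n0; apply: unitary_equivalence.
- exact: rhoM.
- exact: rho1.
- exact: rho_adj.
- exact: rhoM.
- exact: rho1.
- exact: rho_adj.
apply: mxtrace_rho_eq => // m; have [x [y [xyd xyr]]] := YB_roots C d r.
by rewrite (mxtrace_ptr_pow HP m xyd xyr) (mxtrace_ptr_pow HP' m xyd xyr).
Qed.

Theorem proposition6p3 (K : realType) :
  ((forall d r : nat, (0 < d)%N ->
      ((exists P : 'M[K[i]]_(d ^ 2), is_YBrep_TL2 r P) <->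
       (exists k : nat, d%:Z ^+ 2 - 4 * r%:Z = k%:Z ^+ 2)))
   /\
   (forall (d r d' r' : nat)
      (P : 'M[K[i]]_(d ^ 2)) (P' : 'M[K[i]]_(d' ^ 2)),
      is_YBrep_TL2 r P -> is_YBrep_TL2 r' P' ->
      (YB_equiv (Rmatrix_of P) (Rmatrix_of P') <-> d = d' /\ r = r')))
  /\
  (forall (d r : nat) (S : 'M[K[i]]_(d ^ 2)),
     is_Rmatrix S -> TL_type S -> has_rank S r ->
     (exists alpha beta : nat -> K, is_Thoma_params (YB_char S) alpha beta) /\
     (forall alpha beta : nat -> K, is_Thoma_params (YB_char S) alpha beta ->
        [/\ forall i, alpha i = 0,
            beta 0%N = 2^-1 * (1 + Num.sqrt (1 - 4 * r%:R / d%:R ^+ 2)),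
            beta 1%N = 2^-1 * (1 - Num.sqrt (1 - 4 * r%:R / d%:R ^+ 2))
          & forall i, (2 <= i)%N -> beta i = 0])).
Proof.
split; first split=> [d r d0|d r d' r' P P']; last 2 first.
- exact: YB_equivP.
- move=> d r S SR STL Sr; split; first exact: TL_Thoma_exists SR STL Sr.
  by move=> alpha beta; apply: TL_Thoma_unique.
split=> [[P HP]|[k kE]]; first exact: TL_disc_square HP.
have [x xd ->] := nat_square_split kE.
by exists (mixed_sym K[i] d x); apply: mixed_sym_YBrep.
Qed.
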